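(* Let $(\mathcal{X},d_{\mathcal{X}})$ and $(\mathcal{Y},d_{\mathcal{Y}})$ be separable metric spaces and let $(Z_i)_{i\in\mathbb{N}}=((X_i,Y_i))_{i\in\mathbb{N}}$ be an i.i.d. sequence of random elements of $\mathcal{X}\times\mathcal{Y}$, defined on a probability space $(\Omega,\mathcal{F},P)$, with distribution $\theta$. If $\theta\in M_1^{1,1}(\mathcal{X}\times\mathcal{Y})$, then $$\tilde U_n^6(h,Z_{1,n})\longrightarrow dcov(\theta)\quad\text{as } n\to\infty,\ P\text{-almost surely}.$$ If it furthermore holds that $E\big([d_{\mathcal{X}}(X_1,x)d_{\mathcal{Y}}(Y_1,y)]^{5/6}\big)<\infty$ for any $x\in\mathcal{X}$ and $y\in\mathcal{Y}$, then $$V_n^6(h,Z_{1,n})\longrightarrow dcov(\theta)\quad\text{as } n\to\infty,\ P\text{-almost surely}.$$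
   Context: $M_1^{1,1}(\mathcal{X}\times\mathcal{Y})$ is the set of probability measures $\theta$ on $\mathcal{B}(\mathcal{X})\otimes\mathcal{B}(\mathcal{Y})$ whose marginals $\mu$ on $\mathcal{X}$ and $\nu$ on $\mathcal{Y}$ have finite first moment, i.e. $\int d_{\mathcal{X}}(x,o)\,d\mu(x)<\infty$ for some (equivalently every) $o\in\mathcal{X}$, and similarly for $\nu$. $a_\mu(x)=\int d_{\mathcal{X}}(x,y)\,d\mu(y)$, $D(\mu)=\int a_\mu\,d\mu$, $d_\mu(x_1,x_2)=d_{\mathcal{X}}(x_1,x_2)-a_\mu(x_1)-a_\mu(x_2)+D(\mu)$, analogously for $\nu$, and $dcov(\theta)=\int d_\mu(x_1,x_2)d_\nu(y_1,y_2)\,d(\theta\times\theta)((x_1,y_1),(x_2,y_2))$. Kernel: $f_{\mathcal{X}}(x_1,x_2,x_3,x_4)=d_{\mathcal{X}}(x_1,x_2)-d_{\mathcal{X}}(x_1,x_3)-d_{\mathcal{X}}(x_2,x_4)+d_{\mathcal{X}}(x_3,x_4)$, $f_{\mathcal{Y}}$ defined likewise with $d_{\mathcal{Y}}$, and $h((x_1,y_1),\dots,(x_6,y_6))=f_{\mathcal{X}}(x_1,x_2,x_3,x_4)\,f_{\mathcal{Y}}(y_1,y_2,y_5,y_6)$. Estimators based on $Z_{1,n}=(Z_1,\dots,Z_n)$: $V_n^6(h,Z_{1,n})=\frac{1}{n^6}\sum_{i_1=1}^n\cdots\sum_{i_6=1}^n h(Z_{i_1},\dots,Z_{i_6})$,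 and for $n>6$, $\tilde U_n^6(h,Z_{1,n})=\frac{1}{n(n-1)\cdots(n-5)}\sum h(Z_{i_1},\dots,Z_{i_6})$, the sum being over all ordered 6-tuples $(i_1,\dots,i_6)$ of pairwise distinct indices in $\{1,\dots,n\}$. *)

(* Defs.v *)
From HB Require Import structures.
From mathcomp Require Import all_boot all_order all_algebra finmap.
From mathcomp Require Import all_classical all_reals all_analysis.

Set Implicit Arguments.
Unset Strict Implicit.
Unset Printing Implicit Defensive.

Import Order.TTheory GRing.Theory Num.Theory.
Import numFieldNormedType.Exports.

Local Open Scope classical_set_scope.
Local Open Scope ring_scope.

(* A measurableType carries a base point, hence so must a metric space to be
   equipped with its Borel sigma-algebra; a metric space in which some random
   element takes its values is nonempty anyway. *)
#[short(type="pmetricType")]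
HB.structure Definition PMetric (K : numDomainType) :=
  {M of Metric K M & Pointed M}.

Definition separable (T : topologicalType) :=
  exists2 D : set T, countable D & dense D.

Notation borel X := (g_sigma_algebraType (@open X)).

Section projections.
Context d1 d2 (T1 : measurableType d1) (T2 : measurableType d2).

HB.instance Definition _ := isMeasurableFun.Build _ _ _ _
  (@fst T1 T2) measurable_fst.
HB.instance Definition _ := isMeasurableFun.Build _ _ _ _
  (@snd T1 T2) measurable_snd.

End projections.

Section random_elements.
Context d d' (T : measurableType d) (T' : measurableType d') (R : realType).
Variable P : probability T R.

(* Measures are functions on all subsets, with no meaning outside the
   measurable ones. *)
Definition has_distribution (X : {RV P >-> T'}) (theta : probability T' R) :=
  forall A, measurable A -> distribution P X A = theta A.

Definition mutually_independent (I : choiceType) (Z : I -> {RV P >-> T'}) :=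
  forall (J : {fset I}) (A : I -> set T'),
    (forall i, i \in J -> measurable (A i)) ->
    P (\bigcap_(i in [set` J]) Z i @^-1` A i)
    = (\prod_(i <- J) P (Z i @^-1` A i))%E.

Definition iid (I : choiceType) (Z : I -> {RV P >-> T'})
    (theta : probability T' R) :=
  mutually_independent Z /\ forall i, has_distribution (Z i) theta.

End random_elements.

Section marginals.
Context d1 d2 (T1 : measurableType d1) (T2 : measurableType d2) (R : realType).
Variable theta : probability (T1 * T2)%type R.

Definition marginal1 : probability T1 R := distribution theta (@fst T1 T2).
Definition marginal2 : probability T2 R := distribution theta (@snd T1 T2).

End marginals.

Section one_space.
Context (R : realType) (X : pmetricType R).
Variable mu : probability (borel X) R.

Definition finite_first_moment :=
  exists o : X, (\int[mu]_x (mdist (x : X) o)%:E < +oo)%E.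

Definition a_mu (x : X) : R := \int[mu]_y mdist x (y : X).

Definition D_mu : R := \int[mu]_x a_mu x.

Definition d_mu (x1 x2 : X) : R := mdist x1 x2 - a_mu x1 - a_mu x2 + D_mu.

End one_space.

Section distance_covariance.
Context (R : realType) (X Y : pmetricType R).
Variable theta : probability (borel X * borel Y)%type R.

Definition M11 :=
  finite_first_moment (marginal1 theta) /\
  finite_first_moment (marginal2 theta).

Definition dcov : R :=
  \int[(theta \x theta)%E]_z
    (d_mu (marginal1 theta) z.1.1 z.2.1 * d_mu (marginal2 theta) z.1.2 z.2.2).

End distance_covariance.

Definition f_kernel (R : realType) (X : pmetricType R) (x1 x2 x3 x4 : X) : R :=
  mdist x1 x2 - mdist x1 x3 - mdist x2 x4 + mdist x3 x4.

(* The arguments z_1, ..., z_6 are z 0, ..., z 5. *)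
Definition h_kernel (R : realType) (X Y : pmetricType R) (z : 'I_6 -> X * Y)
    : R :=
  f_kernel (z 0).1 (z 1).1 (z 2).1 (z 3).1 *
  f_kernel (z 0).2 (z 1).2 (z 4).2 (z 5).2.

Section estimators.
Context (R : realType) (T : Type) (m : nat).
Variables (k : ('I_m -> T) -> R) (n : nat) (z : 'I_n -> T).

Definition Vstat : R :=
  (n%:R ^+ m)^-1 * \sum_(i : {ffun 'I_m -> 'I_n}) k (fun j => z (i j)).

(* n ^_ m = n (n - 1) ... (n - m + 1); the value is 0 when n < m. *)
Definition Ustat : R :=
  (n ^_ m)%:R^-1 *
  \sum_(i : {ffun 'I_m -> 'I_n} | injectiveb i) k (fun j => z (i j)).

End estimators.

(* Main.v *)
Require Import Defs.
From HB Require Import structures.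
From mathcomp Require Import all_boot all_order all_algebra finmap.
From mathcomp Require Import all_classical all_reals all_analysis.
From mathcomp Require Import measurable_realfun ring lra.

Set Implicit Arguments.
Unset Strict Implicit.
Unset Printing Implicit Defensive.

Import Order.TTheory GRing.Theory Num.Theory.
Import numFieldNormedType.Exports.

Local Open Scope classical_set_scope.
Local Open Scope ring_scope.

(** Write [z_0, ..., z_5] for the arguments of the kernel, [z_i = (x_i, y_i)].
    The four terms of [f_kernel] pair off into differences of distances to a
    common point, which bounds the factor over [X] both by [2 d(x_1, x_2)] and
    by [2 d(x_0, x_3)], and the factor over [Y] both by [2 d(y_1, y_4)] and by
    [2 d(y_0, y_5)].  Whatever the index of an [x_i], one of the two bounds on
    the factor over [Y] avoids that index, and conversely.  Hence a perturbation
    of the arguments changes the kernel by at most a combination of products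
    [u(z_i) v(z_j)] with [i <> j].  Over all tuples of sample points, with or
    without repetition, the mean of such a product is controlled by the product
    of the averages of [u] and of [v] ([Vstat_mul2], [ler_dist_Ustat]), so that
    first moments suffice.

    The perturbation is quantization: fix a base point [s 0] followed by a dense
    sequence, and replace every point by a nearest one among [s 0, ..., s N].
    The quantization error tends to [0] in [L^1] and is at most the distance to
    [s 0], which is integrable.  The quantized kernel factors through a finite
    set of cells.  Its V-statistic is a polynomial in the empirical frequencies
    of the cells, which converge by the strong law ([Vstat_factor_cvg]); its
    U-statistic has the same limit because the kernel is bounded and almost all
    tuples are injective ([ler_dist_Ustat_Vstat]).  Letting first the sample size
    and then [N] grow gives the limit for the kernel itself
    ([Vstat_cvg_approx], [Ustat_cvg_approx]).

    It remains to see that the limits for the quantized kernel tend to [dcov].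
    Given the first two arguments, the pairs of indices [2, 3] and [4, 5] are
    independent, and averaging over them centres the two distances
    ([six_fold_sum]); the limit for the quantized kernel is therefore an integral
    against [theta \x theta] of a product of doubly centred quantized distances.
    Dominated convergence applies since the centred distances are bounded by
    a function of either of their two arguments ([centred_bound]), which yields
    a dominating function of the form [u(z) v(w)] ([quant_dcov_cvg]).

    Two laws of large numbers are used: convergence of averages of bounded
    functions ([bounded_strong_law]), for the cell frequencies, and for
    integrable nonnegative functions the bound of the upper limit by twice the
    expectation ([avg_limsup_le]), for the quantization errors and the distances
    to the base point. *)

(** * Laws of large numbers *)

Definition avg (R : realType) (T : Type) (u : T -> R) (z : nat -> T) (n : nat)
  : R := n%:R^-1 * \sum_(i < n) u (z i).

Section ae_convergence.
Context d (T : measurableType d) (R : realType).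
Variable mu : {measure set T -> \bar R}.

(** By monotone convergence the series of the [f k] has a finite integral, hence
    is finite almost everywhere, so that its terms tend to [0]. *)
Lemma ae_cvg0_of_summable_integrals (f : nat -> T -> R) (C : R) :
  (forall k, measurable_fun setT (f k)) -> (forall k x, 0 <= f k x) ->
  (forall K, \sum_(0 <= k < K) \int[mu]_x (f k x)%:E <= C%:E)%E ->
  {ae mu, forall x, f k x @[k --> \oo] --> 0}.
Proof.
move=> mf f0 fC.
pose F (x : T) : \bar R := (\sum_(0 <= k <oo) (f k x)%:E)%E.
have F0 x : (0 <= F x)%E.
  by apply: nneseries_ge0 => k _ _; rewrite lee_fin.
have mF : measurable_fun setT F.
  apply: ge0_emeasurable_sum => //.
  - by move=> k x _ _; rewrite lee_fin.
  - by move=> k _; exact/measurable_EFinP.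
have iF : mu.-integrable setT F.
  apply/integrableP; split => //.
  under eq_integral do rewrite gee0_abs//.
  rewrite /F integral_nneseries//; last 2 first.
  - by move=> k; exact/measurable_EFinP.
  - by move=> k x _; rewrite lee_fin.
  apply: (@le_lt_trans _ _ C%:E); last by rewrite ltry.
  apply: lime_le.
    by apply: is_cvg_nneseries => k _ _; apply: integral_ge0 => x _; rewrite lee_fin.
  exact: nearW.
have := integrable_ae measurableT iF; apply: filterS => x /= /(_ I) Ffin.
apply: cvg_series_cvg_0; apply: nondecreasing_is_cvgn.
  by apply: nondecreasing_series => k _ _.
exists (fine (F x)) => _ [K _ <-].
rewrite -lee_fin fineK// /series/= -sumEFin.
by apply: nneseries_lim_ge => k _ _; rewrite lee_fin.
Qed.

End ae_convergence.

Section iid_averages.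
Context d d' (Omega : measurableType d) (T : measurableType d') (R : realType).
Variables (P : probability Omega R) (theta : probability T R).
Variable Z : nat -> {RV P >-> T}.
Hypothesis iidZ : iid Z theta.

Lemma iid_ge0_integral (i : nat) (u : T -> \bar R) :
  measurable_fun setT u -> (forall x, 0 <= u x)%E ->
  (\int[P]_w u (Z i w) = \int[theta]_x u x)%E.
Proof.
move=> mu u0.
rewrite [RHS](eq_measure_integral (distribution P (Z i))); last first.
  by move=> A mA _; apply/esym/(iidZ.2 i).
by rewrite ge0_integral_pushforward// => x _.
Qed.

(** Independence gives the product rule on rectangles, which determines a product
    measure. *)
Lemma iid_pair_law (i j : nat) (A : set (T * T)) : i != j -> measurable A ->
  P ((fun w => (Z i w, Z j w)) @^-1` A) = (theta \x theta)%E A.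
Proof.
move=> ij mA.
have mZ : measurable_fun setT (fun w => (Z i w, Z j w)).
  by apply/measurable_fun_pair.
pose ZZ : {mfun Omega >-> (T * T)%type} :=
  HB.pack (fun w => (Z i w, Z j w)) (isMeasurableFun.Build _ _ _ _ _ mZ).
rewrite (@product_measure_unique _ _ _ _ _ theta theta (distribution P ZZ))//.
move=> B C mB mC.
pose BC k := if k == i then B else C.
have := iidZ.1 [fset i; j]%fset BC.
have mBC k : measurable (BC k) by rewrite /BC; case: ifP.
move=> /(_ (fun k _ => mBC k)).
rewrite big_fsetU1 ?inE//= big_seq_fset1 /BC eqxx eq_sym (negbTE ij).
have E k (D : set T) : measurable D -> P (Z k @^-1` D) = theta D.
  by move=> mD; exact: (iidZ.2 k).
rewrite !E// => <-.
congr (P _); apply/seteqP; split=> w /=.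
  move=> [wB wC] k /=; rewrite !inE => /orP[] /eqP ->.
    by rewrite eqxx.
  by rewrite eq_sym (negbTE ij).
move=> H; split.
  by have := H i; rewrite /= !inE eqxx => /(_ isT).
by have := H j; rewrite /= !inE eqxx orbT eq_sym (negbTE ij) => /(_ isT).
Qed.

Lemma bounded_integrable d0 (U : measurableType d0) (mu : probability U R)
    (u : U -> R) (B : R) :
  measurable_fun setT u -> (forall x, `|u x| <= B) ->
  mu.-integrable setT (EFin \o u).
Proof.
move=> mu_ uB; apply: measurable_bounded_integrable => //.
  by rewrite (le_lt_trans (probability_le1 _ _))// ltry.
exists B; split; first exact: num_real.
by move=> M BM x _; apply: le_trans (uB x) (ltW BM).
Qed.

Lemma EFin_Rintegral d0 (U : measurableType d0) (mu : {measure set U -> \bar R})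
    (u : U -> R) : mu.-integrable setT (EFin \o u) ->
  (\int[mu]_x (u x)%:E)%E = (\int[mu]_x u x)%:E.
Proof. by move=> iu; rewrite /Rintegral fineK//; exact: integrable_fin_num. Qed.

Lemma iid_uncorrelated (u : T -> R) (B : R) (i j : nat) :
  measurable_fun setT u -> (forall x, `|u x| <= B) -> i != j ->
  (\int[P]_w (u (Z i w) * u (Z j w))%:E = ((\int[theta]_x u x) ^+ 2)%:E)%E.
Proof.
move=> mu uB ij.
have B0 : 0 <= B by exact: le_trans (normr_ge0 _) (uB point).
have iu : theta.-integrable setT (EFin \o u) by exact: (bounded_integrable _ mu uB).
pose f (z : T * T) := u z.1 * u z.2.
have mf : measurable_fun setT f.
  by apply: measurable_funM; exact: measurableT_comp.
have fB z : `|f z| <= B * B by rewrite normrM ler_pM.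
have mZ : measurable_fun setT (fun w => (Z i w, Z j w)).
  by apply/measurable_fun_pair.
pose ZZ : {mfun Omega >-> (T * T)%type} :=
  HB.pack (fun w => (Z i w, Z j w)) (isMeasurableFun.Build _ _ _ _ _ mZ).
have mfE : measurable_fun setT (EFin \o f) by exact/measurable_EFinP.
transitivity (\int[distribution P ZZ]_z (EFin \o f) z)%E.
  rewrite integral_pushforward//.
  apply: (@bounded_integrable _ _ P (f \o ZZ) (B * B)).
    exact: measurableT_comp.
  by move=> w; exact: fB.
transitivity (\int[(theta \x theta)%E]_z (EFin \o f) z)%E.
  by apply: eq_measure_integral => A mA _; exact: iid_pair_law.
rewrite -integral12_prod_meas1/=; last exact: (@bounded_integrable _ _ _ f (B * B)).
rewrite /fubini_F/= /f/=.
transitivity (\int[theta]_x ((\int[theta]_y u y)%:E * (u x)%:E))%E.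
  apply: eq_integral => x _; rewrite -EFin_Rintegral// muleC.
  by rewrite -integralZl.
rewrite integralZl//= EFin_Rintegral// -EFinM.
Qed.

(** The average of [n] independent copies has [n^-1] times the variance of one
    copy, and the second moment dominates the variance. *)
Lemma avg_second_moment (u : T -> R) (B : R) (n : nat) :
  measurable_fun setT u -> (forall x, `|u x| <= B) -> (0 < n)%N ->
  (\int[P]_w ((avg u (Z ^~ w) n - \int[theta]_x u x) ^+ 2)%:E
   <= (n%:R^-1 * \int[theta]_x u x ^+ 2)%:E)%E.
Proof.
move=> mu uB n0; set c := \int[theta]_x u x.
have B0 : 0 <= B by exact: le_trans (normr_ge0 _) (uB point).
have iu : theta.-integrable setT (EFin \o u) by exact: (bounded_integrable _ mu uB).
have mu2 : measurable_fun setT (fun x => u x ^+ 2) by exact: measurable_funX.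
have u2B x : `|u x ^+ 2| <= B ^+ 2 by rewrite normrX lerXn2r ?nnegrE.
have iu2 := bounded_integrable theta mu2 u2B.
have th1 : fine (theta setT) = 1 by rewrite probability_setT.
have nR : n%:R != 0 :> R by rewrite pnatr_eq0 -lt0n.
pose v x := u x - c.
have mv : measurable_fun setT v by exact: measurable_funB.
have vB x : `|v x| <= B + `|c| by rewrite (le_trans (ler_normB _ _))// lerD2r.
have v0 : \int[theta]_x v x = 0.
  rewrite RintegralB//; last exact: (@bounded_integrable _ _ _ _ `|c|).
  by rewrite Rintegral_cst//= th1 mulr1 subrr.
have mv2 : measurable_fun setT (fun x => v x ^+ 2) by exact: measurable_funX.
have vE : \int[theta]_x (v x ^+ 2) = \int[theta]_x (u x ^+ 2) - c ^+ 2.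
  transitivity (\int[theta]_x (u x ^+ 2 - (2 * c * u x - c ^+ 2))).
    by apply: eq_Rintegral => x _; rewrite /v; ring.
  have i2u : theta.-integrable setT (EFin \o (fun x => 2 * c * u x)).
    apply: (@bounded_integrable _ _ _ _ (`|2 * c| * B)).
      exact: measurable_funM.
    by move=> x; rewrite normrM ler_wpM2l.
  have ic : theta.-integrable setT (EFin \o (fun x : T => c ^+ 2)).
    exact: (@bounded_integrable _ _ _ _ `|c ^+ 2|).
  rewrite RintegralB//; last first.
    exact: (integrableB measurableT i2u ic).
  rewrite RintegralB// RintegralZl// Rintegral_cst//=.
  by rewrite -/c th1; ring.
have vvB i j w : `|v (Z i w) * v (Z j w)| <= (B + `|c|) * (B + `|c|).
  by rewrite normrM ler_pM.
have iZ i j : P.-integrable setT (EFin \o (fun w => v (Z i w) * v (Z j w))).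
  apply: (@bounded_integrable _ _ P _ _ _ (vvB i j)).
  by apply: measurable_funM; exact: measurableT_comp.
have E w : (((avg u (Z ^~ w) n - c) ^+ 2)%:E =
    (n%:R ^- 2)%:E * \sum_(i < n) \sum_(j < n) (v (Z i w) * v (Z j w))%:E)%E.
  under eq_bigr do rewrite sumEFin.
  rewrite sumEFin -EFinM; congr _%:E.
  under eq_bigr do rewrite -mulr_sumr.
  rewrite -mulr_suml /v sumrB sumr_const card_ord /avg -mulr_natl.
  by field.
under eq_integral do rewrite E.
have iZs (i : nat) : P.-integrable setT
    (fun w => \sum_(j < n) (v (Z i w) * v (Z j w))%:E)%E.
  by apply: integrable_sum => // j _; exact: iZ.
rewrite integralZl//; last by apply: integrable_sum => // i _; exact: iZs.
rewrite integral_sum//.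
have S (i : 'I_n) : (\int[P]_w \sum_(j < n) (v (Z i w) * v (Z j w))%:E =
     (\int[theta]_x v x ^+ 2)%:E)%E.
  rewrite integral_sum//; last by move=> j; exact: iZ.
  rewrite (bigD1 i)//= big1 => [|j ji].
    rewrite adde0 -EFin_Rintegral.
      apply: (iid_ge0_integral i (u := fun x => (v x * v x)%:E)).
        by apply/measurable_EFinP; exact: measurable_funM.
      by move=> x; rewrite lee_fin -expr2 sqr_ge0.
    apply: (@bounded_integrable _ _ _ _ ((B + `|c|) ^+ 2)) => // x.
    by rewrite normrX lerXn2r ?nnegrE// addr_ge0.
  by rewrite (iid_uncorrelated mv vB) 1?eq_sym// v0 expr0n.
under eq_bigr do rewrite S.
rewrite sumEFin -EFinM lee_fin sumr_const card_ord vE -[X in _ * X <= _]mulr_natl.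
rewrite mulrA expr2 invfM -(mulrA _ _ n%:R) mulVf// mulr1.
by rewrite ler_pM2l ?invr_gt0 ?ltr0n// gerBl sqr_ge0.
Qed.

Lemma sqr_cvg0 (f : nat -> R) : f k ^+ 2 @[k --> \oo] --> 0 ->
  f k @[k --> \oo] --> 0.
Proof.
move=> /cvgr0Pnorm_lt f2; apply/cvgr0Pnorm_lt => e e0.
have := f2 _ (exprn_gt0 2 e0); apply: filterS => k; rewrite normrX ltr_pXn2r ?nnegrE//; exact: ltW.
Qed.

(** The variances are summable along the sample sizes [n k], so the squared
    deviations are summable almost surely. *)
Lemma bounded_strong_law_along (u : nat -> T -> R) (B : nat -> R) (n : nat -> nat)
    (C : R) :
  (forall k, measurable_fun setT (u k)) -> (forall k x, `|u k x| <= B k) ->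
  (forall k, (0 < n k)%N) ->
  (forall K, \sum_(0 <= k < K) (n k)%:R^-1 * \int[theta]_x (u k x ^+ 2) <= C) ->
  {ae P, forall w, avg (u k) (Z ^~ w) (n k) - \int[theta]_x u k x
                   @[k --> \oo] --> 0}.
Proof.
move=> mu uB n0 uC.
have mavg k : measurable_fun setT (fun w => avg (u k) (Z ^~ w) (n k)).
  apply: measurable_funM => //; apply: measurable_sum => i.
  exact: measurableT_comp.
have := @ae_cvg0_of_summable_integrals _ _ _ P
  (fun k w => (avg (u k) (Z ^~ w) (n k) - \int[theta]_x u k x) ^+ 2) C.
case.
- by move=> k; apply: measurable_funX; exact: measurable_funB.
- by move=> k w; exact: sqr_ge0.
- move=> K; apply: (@le_trans _ _
    (\sum_(0 <= k < K) ((n k)%:R^-1 * \int[theta]_x (u k x ^+ 2))%:E)%E).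
    by apply: lee_sum => k _; exact: (avg_second_moment (mu k) (uB k)).
  by rewrite sumEFin lee_fin.
- move=> N [mN N0 NP]; exists N; split => // w /= nw.
  by apply: NP => /= nw'; apply: nw; exact: sqr_cvg0.
Qed.

End iid_averages.

Section deterministic_averages.
Context (R : realType) (T : Type) (z : nat -> T).

Lemma avg_ge0 (g : T -> R) n : (forall x, 0 <= g x) -> 0 <= avg g z n.
Proof. by move=> g0; rewrite mulr_ge0// sumr_ge0. Qed.

Lemma ler_sum_prefix (g : T -> R) m n : (forall x, 0 <= g x) -> (m <= n)%N ->
  \sum_(i < m) g (z i) <= \sum_(i < n) g (z i).
Proof.
move=> g0 mn; rewrite -!(big_mkord xpredT (fun i => g (z i))).
by rewrite (big_cat_nat (leq0n m) mn)//= lerDl sumr_ge0.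
Qed.

(** For [2 ^ k <= n < 2 ^ k.+1] the sum of the first [n] values is at most that of
    the first [2 ^ k.+1 <= 2 * n] values. *)
Lemma avg_le_dyadic (g : T -> R) (c : R) : (forall x, 0 <= g x) ->
  (\forall k \near \oo, avg g z (2 ^ k) <= c) ->
  \forall n \near \oo, avg g z n <= 2 * c.
Proof.
move=> g0 [K _ Kc]; exists (2 ^ K)%N => // n /= Kn.
have n0 : (0 < n)%N by rewrite (leq_trans _ Kn)// expn_gt0.
set k := (trunc_log 2 n).+1.
have nk : (n < 2 ^ k)%N by exact: trunc_log_ltn.
have kn : (2 ^ k <= 2 * n)%N by rewrite expnS leq_pmul2l// trunc_logP.
have Kk : (K <= k)%N.
  by rewrite -(@leq_exp2l 2)// (leq_trans Kn)// ltnW.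
have H := Kc k Kk; rewrite /avg in H *.
have k0 : 0 < (2 ^ k)%:R :> R by rewrite ltr0n expn_gt0.
rewrite mulrC ler_pdivrMr// in H.
rewrite mulrC ler_pdivrMr ?ltr0n//.
apply: le_trans (ler_sum_prefix g0 (ltnW nk)) _; apply: (le_trans H).
have c0 : 0 <= c.
  rewrite -(pmulr_lge0 _ k0); apply: le_trans H; exact: sumr_ge0.
by rewrite -mulrA mulrCA ler_wpM2l// -natrM ler_nat.
Qed.

Lemma nat_sqrt_exists (n : nat) : exists k, (k ^ 2 <= n < k.+1 ^ 2)%N.
Proof.
elim: n => [|n [k /andP[kn nk]]]; first by exists 0%N.
have [h|h] := ltnP n.+1 (k.+1 ^ 2); first by exists k; rewrite leqW.
by exists k.+1; rewrite h/= (leq_ltn_trans nk)// ltn_exp2r.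
Qed.

(** Between [k ^ 2] and [k.+1 ^ 2] there are only [2 * k] further terms, each
    in [0, 1], which move the average by at most [2 / k]. *)
Lemma avg_cvg_squares (u : T -> R) (c : R) : (forall x, 0 <= u x <= 1) ->
  avg u z (k.+1 ^ 2) @[k --> \oo] --> c -> avg u z n @[n --> \oo] --> c.
Proof.
move=> u01 /cvgrPdist_lt uc; apply/cvgrPdist_lt => e e0.
have e20 : 0 < e / 2 by rewrite divr_gt0.
have [K _ Kc] := uc _ e20.
pose M := (maxn K (Num.truncn (4 / e))).+1.
exists (M ^ 2)%N => // n /= Mn.
have [k /andP[kn nk]] := nat_sqrt_exists n.
have Mk : (M <= k)%N by rewrite -ltnS -(@ltn_exp2r _ _ 2)// (leq_ltn_trans Mn).
have k0 : (0 < k)%N by exact: leq_trans Mk.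
have kR : 0 < k%:R :> R by rewrite ltr0n.
have nR : 0 < n%:R :> R.
  by rewrite ltr0n (leq_trans _ kn)// expn_gt0 k0.
have /= := Kc k.-1; rewrite prednK// => /(_ _)/wrap[].
  by rewrite -ltnS prednK// (leq_trans _ Mk)// ltnS leq_maxl.
move=> H; rewrite (_ : c - avg u z n = (c - avg u z (k ^ 2)) +
  (avg u z (k ^ 2) - avg u z n)); last by ring.
apply: le_lt_trans (ler_normD _ _) _; rewrite [ltRHS]splitr ltr_leD//.
set m := (k ^ 2)%N in kn H *.
have m0 : 0 < m%:R :> R by rewrite ltr0n expn_gt0 k0.
pose Sm := \sum_(i < m) u (z i).
pose D := \sum_(m <= i < n) u (z i).
have Sn : \sum_(i < n) u (z i) = Sm + D.
  rewrite /Sm -!(big_mkord xpredT (fun i => u (z i))).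
  by rewrite (big_cat_nat (leq0n m) kn).
have Sm0 : 0 <= Sm by apply: sumr_ge0 => i _; case/andP: (u01 (z i)).
have Sm1 : Sm <= m%:R.
  rewrite (_ : m%:R = \sum_(i < m) 1); last by rewrite sumr_const card_ord.
  by apply: ler_sum => i _; case/andP: (u01 (z i)).
have D0 : 0 <= D by apply: sumr_ge0 => i _; case/andP: (u01 (z i)).
have D1 : D <= n%:R - m%:R.
  rewrite -natrB// (_ : (n - m)%:R = \sum_(m <= i < n) 1); last first.
    by rewrite sumr_const_nat.
  by apply: ler_sum => i _; case/andP: (u01 (z i)).
have nm : n%:R - m%:R <= 2 * k%:R :> R.
  rewrite lerBlDr -natrM -natrD ler_nat -ltnS (leq_trans nk)//.
  by rewrite /m -addn1 sqrnD muln1 exp1n addnAC addn1 addnC.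
have mk : m%:R = k%:R ^+ 2 :> R by rewrite natrX.
have ke : 4 / e <= k%:R.
  apply: ltW; apply: lt_le_trans (truncnS_gt _) _; rewrite ler_nat.
  by rewrite (leq_trans _ Mk)// ltnS leq_maxr.
have E : avg u z m - avg u z n = (Sm * (n%:R - m%:R) - D * m%:R) / (m%:R * n%:R).
  by rewrite /avg Sn -/Sm; field; rewrite !gt_eqF.
have mn0 : 0 <= n%:R - m%:R :> R by rewrite subr_ge0 ler_nat.
have mnR : 0 < m%:R * n%:R :> R by exact: mulr_gt0.
rewrite E normrM normfV (gtr0_norm mnR) ler_pdivrMr//.
have B1 : `|Sm * (n%:R - m%:R) - D * m%:R| <= m%:R * (n%:R - m%:R).
  rewrite ler_norml; apply/andP; split; nra.
apply: (le_trans B1).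
have ke2 : 4 <= k%:R * e by rewrite -ler_pdivrMr.
have mn : m%:R <= n%:R :> R by rewrite ler_nat.
rewrite mulrCA ler_pM2l//.
apply: (le_trans nm).
apply: (@le_trans _ _ (e / 2 * m%:R)); last by rewrite ler_pM2l.
rewrite mk; nra.
Qed.

End deterministic_averages.

Lemma sum_inv_squares (R : realType) (K : nat) :
  \sum_(0 <= k < K) (k.+1 ^ 2)%:R^-1 <= 2 :> R.
Proof.
case: K => [|K]; first by rewrite big_nil.
(* Telescoping: [1 / k.+1 ^ 2 <= 1 / k - 1 / k.+1] for positive [k]. *)
apply: (@le_trans _ _ (2 - K.+1%:R^-1)); last by rewrite gerBl invr_ge0.
elim: K => [|K IH]; first by rewrite big_nat1 exp1n !invr1; lra.
rewrite big_nat_recr//= (le_trans (lerD IH (lexx _)))// natrX.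
rewrite -[K.+2]addn1 natrD; set x := K.+1%:R.
have x0 : 0 < x :> R by rewrite ltr0n.
rewrite -subr_ge0 (_ : _ - _ = (x * (x + 1) ^+ 2)^-1).
  by rewrite invr_ge0 mulr_ge0// ?sqr_ge0// ltW.
by clearbody x; field; rewrite !gt_eqF ?addr_gt0.
Qed.

(** The powers of two below [x] add up to less than twice the largest of them.
    In expectation, with [x] an integrable variable, the bound says that the
    expected numbers of values above [2 ^ k] among [2 ^ k] copies are summable. *)
Lemma sum_powers_below (R : realType) (x : R) (K : nat) : 0 <= x ->
  \sum_(0 <= k < K) (2 ^ k)%:R * ((2 ^ k)%:R < x)%R%:R <= 2 * x.
Proof.
move=> x0; elim: K => [|K IH]; first by rewrite big_nil mulr_ge0.
rewrite big_nat_recr//=; case: ltP => [Kx|_] /=; last by rewrite mulr0 addr0.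
rewrite mulr1.
apply: (@le_trans _ _ ((2 ^ K)%:R + (2 ^ K)%:R)); last by lra.
rewrite lerD2r; apply: (@le_trans _ _ ((2 ^ K)%:R - 1)); last by rewrite gerBl.
elim: K {IH Kx} => [|K IH]; first by rewrite big_nil expn0 subrr.
rewrite big_nat_recr//= expnS natrM (le_trans (lerD IH (lexx _)))//.
have : (2 ^ K)%:R * ((2 ^ K)%:R < x)%R%:R <= (2 ^ K)%:R :> R.
  by rewrite ler_piMr// lern1 leq_b1.
lra.
Qed.

(** The inverse powers of two with [x <= 2 ^ k] sum to at most [2 / x]; applied
    to a truncated variable, this makes the variances at the sample sizes [2 ^ k]
    summable under a first moment only. *)
Lemma sum_inv_powers_above (R : realType) (x : R) (K : nat) : 0 <= x ->
  \sum_(0 <= k < K) (2 ^ k)%:R^-1 * (if x <= (2 ^ k)%:R then x else 0) ^+ 2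
  <= 2 * x.
Proof.
move=> x0.
(* The subtracted term is the tail of the geometric series, which makes the
   induction go through. *)
suff : \sum_(0 <= k < K) (2 ^ k)%:R^-1 * (if x <= (2 ^ k)%:R then x else 0) ^+ 2
   <= if x <= (2 ^ K)%:R then 2 * x - 2 * (2 ^ K)%:R^-1 * x ^+ 2 else 0.
  move/le_trans; apply; case: ifP => _; last by rewrite mulr_ge0.
  by rewrite gerBl !mulr_ge0// sqr_ge0.
elim: K => [|K IH].
  rewrite big_nil expn0 invr1 mulr1; case: ifP => // x1; nra.
rewrite big_nat_recr//= (le_trans (lerD IH (lexx _)))// expnS natrM invfM.
have p0 : 0 < (2 ^ K)%:R :> R by rewrite ltr0n expn_gt0.
have q0 : 0 < (2 ^ K)%:R^-1 :> R by rewrite invr_gt0.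
have pq : (2 ^ K)%:R * (2 ^ K)%:R^-1 = 1 :> R by rewrite mulfV// gt_eqF.
move: (2 ^ K)%:R (2 ^ K)%:R^-1 p0 q0 pq => p q p0 q0 pq.
case: ifP => [xp|/negbT]; first by rewrite ifT; lra.
rewrite -ltNge => px; rewrite expr0n mulr0 addr0.
case: ifP => // x2p.
suff : q * x <= 2 by nra.
by have := ler_wpM2l (ltW q0) x2p; nra.
Qed.

Section Rintegral_sum.
Context d (T : measurableType d) (R : realType).
Variables (mu : {measure set T -> \bar R}) (f : nat -> T -> R) (K : nat).
Hypothesis fi : forall k, mu.-integrable setT (EFin \o f k).

Lemma integrable_sum_EFin :
  mu.-integrable setT (EFin \o (fun x => \sum_(0 <= k < K) f k x)).
Proof.
have -> : EFin \o (fun x => \sum_(0 <= k < K) f k x) =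
    (fun x => \sum_(0 <= k < K) (f k x)%:E)%E.
  by apply/funext => x /=; rewrite sumEFin.
by apply: integrable_sum => // k _; exact: fi.
Qed.

Lemma Rintegral_sum :
  \int[mu]_x (\sum_(0 <= k < K) f k x) = \sum_(0 <= k < K) \int[mu]_x f k x.
Proof.
apply: EFin_inj; rewrite -EFin_Rintegral//; last exact: integrable_sum_EFin.
rewrite -sumEFin.
under eq_integral do rewrite -sumEFin.
rewrite integral_sum//.
by apply: eq_bigr => k _; exact: EFin_Rintegral.
Qed.

End Rintegral_sum.

Section laws_of_large_numbers.
Context d d' (Omega : measurableType d) (T : measurableType d') (R : realType).
Variables (P : probability Omega R) (theta : probability T R).
Variable Z : nat -> {RV P >-> T}.
Hypothesis iidZ : iid Z theta.

(** Along the squares the variances are summable, and [avg_cvg_squares] fills the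
    gaps. *)
Lemma bounded_strong_law (u : T -> R) : measurable_fun setT u ->
  (forall x, 0 <= u x <= 1) ->
  {ae P, forall w, avg u (Z ^~ w) n @[n --> \oo] --> \int[theta]_x u x}.
Proof.
move=> mu u01.
have uB x : `|u x| <= 1 by rewrite ger0_norm; case/andP: (u01 x).
have u2B x : `|u x ^+ 2| <= 1 by rewrite normrX expr_le1.
have th1 : fine (theta setT) = 1 by rewrite probability_setT.
have I1 : \int[theta]_x (u x ^+ 2) <= 1.
  rewrite -[leRHS](_ : \int[theta]_x 1 = 1).
    apply: le_Rintegral => //.
    - by apply: (bounded_integrable _ _ u2B); exact: measurable_funX.
    - by apply: (@bounded_integrable _ _ _ _ _ 1) => // x; rewrite normr1.
    - by move=> x _; case/ler_normlP: (u2B x).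
  by rewrite Rintegral_cst// mul1r th1.
have := @bounded_strong_law_along _ _ _ _ _ P theta Z iidZ (fun=> u) (fun=> 1)
  (fun k => (k.+1 ^ 2)%N) 2.
case=> //.
  move=> K; apply: le_trans (sum_inv_squares R K); apply: ler_sum => k _.
  by rewrite ler_piMr// invr_ge0.
move=> N [mN N0 NP]; exists N; split => // w /= nw; apply: NP => /= H; apply: nw.
apply: avg_cvg_squares => //.
rewrite -[X in _ --> X]add0r.
have -> : (fun k => avg u (Z ^~ w) (k.+1 ^ 2)) =
  (fun k => (avg u (Z ^~ w) (k.+1 ^ 2) - \int[theta]_x u x) + \int[theta]_x u x).
  by apply/funext => k; rewrite subrK.
by apply: cvgD => //; exact: cvg_cst.
Qed.

(** Truncating the variables of index below [2 ^ k] at [2 ^ k] changes none of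
    them for large [k], and the truncated averages concentrate; monotonicity
    between consecutive powers of two costs the factor two. *)
Lemma avg_limsup_le (g : T -> R) : (forall x, 0 <= g x) ->
  theta.-integrable setT (EFin \o g) ->
  {ae P, forall w, forall c, 2 * \int[theta]_x g x < c ->
    \forall n \near \oo, avg g (Z ^~ w) n <= c}.
Proof.
move=> g0 ig.
have mg : measurable_fun setT g by exact/measurable_EFinP/(measurable_int _ ig).
have mlt k : measurable_fun setT (fun x => (2 ^ k)%:R < g x).
  exact: measurable_fun_ltr.
have mle k : measurable_fun setT (fun x => g x <= (2 ^ k)%:R).
  exact: measurable_fun_ler.
pose W k x := if g x <= (2 ^ k)%:R then g x else 0.
have mW k : measurable_fun setT (W k) by exact: measurable_fun_ifT.
have WB k x : `|W k x| <= (2 ^ k)%:R.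
  by rewrite /W; case: ifP => h; rewrite ?ger0_norm ?normr0.
pose I k x : R := ((2 ^ k)%:R < g x)%R%:R.
have mI k : measurable_fun setT (I k).
  rewrite (_ : I k = fun x => if (2 ^ k)%:R < g x then 1 else 0).
    exact: measurable_fun_ifT.
  by apply/funext => x; rewrite /I; case: ifP.
have i2g : theta.-integrable setT (EFin \o (fun x => 2 * g x)).
  exact: (integrableZl measurableT 2 ig).
have iW k : theta.-integrable setT (EFin \o W k).
  exact: (bounded_integrable _ (mW k) (WB k)).
have iW2 k : theta.-integrable setT (EFin \o (fun x => W k x ^+ 2)).
  apply: (@bounded_integrable _ _ _ _ _ ((2 ^ k)%:R ^+ 2)).
    exact: measurable_funX.
  by move=> x; rewrite normrX lerXn2r ?nnegrE.
have iI k : theta.-integrable setT (EFin \o I k).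
  apply: (@bounded_integrable _ _ _ _ _ 1) => // x.
  by rewrite /I normr_nat lern1 leq_b1.
have sum_le (v : nat -> T -> R) (K : nat) :
    (forall k, theta.-integrable setT (EFin \o v k)) ->
    (forall x, \sum_(0 <= k < K) v k x <= 2 * g x) ->
    \sum_(0 <= k < K) \int[theta]_x v k x <= 2 * \int[theta]_x g x.
  move=> iv vg; rewrite -Rintegral_sum// -RintegralZl//.
  by apply: le_Rintegral => //; exact: integrable_sum_EFin.
have Wlaw : {ae P, forall w, avg (W k) (Z ^~ w) (2 ^ k) - \int[theta]_x W k x
                   @[k --> \oo] --> 0}.
  apply: (bounded_strong_law_along iidZ (C := 2 * \int[theta]_x g x) mW WB).
    by move=> k; rewrite expn_gt0.
  move=> K; under eq_bigr do rewrite -RintegralZl//.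
  apply: (sum_le (fun k x => (2 ^ k)%:R^-1 * W k x ^+ 2)).
    by move=> k; exact: (integrableZl measurableT _ (iW2 k)).
  by move=> x; exact: sum_inv_powers_above.
pose f k w := \sum_(0 <= i < 2 ^ k) I k (Z i w).
(* [f k] counts the observations among the first [2 ^ k] that truncation changes;
   being an integer, it vanishes once it is below [1]. *)
have flaw : {ae P, forall w, f k w @[k --> \oo] --> 0}.
  apply: (@ae_cvg0_of_summable_integrals _ _ _ P f (2 * \int[theta]_x g x)).
  - by move=> k; apply: measurable_sum => i; exact: measurableT_comp.
  - by move=> k w; apply: sumr_ge0 => i _; exact: ler0n.
  move=> K; rewrite (_ : (\sum_(_ <= _ < _) _)%E =
      (\sum_(0 <= k < K) \int[theta]_x ((2 ^ k)%:R * I k x))%:E).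
    rewrite lee_fin; apply: (sum_le (fun k x => (2 ^ k)%:R * I k x)).
      by move=> k; exact: (integrableZl measurableT _ (iI k)).
    by move=> x; exact: sum_powers_below.
  rewrite -sumEFin; apply: eq_bigr => k _; rewrite /f.
  under eq_integral do rewrite -sumEFin.
  rewrite ge0_integral_sum//; last 2 first.
  - by move=> i; apply/measurable_EFinP; exact: measurableT_comp.
  - by move=> i x _; rewrite lee_fin ler0n.
  have E i : (\int[P]_w (I k (Z i w))%:E = (\int[theta]_x I k x)%:E)%E.
    rewrite -EFin_Rintegral//.
    apply: (iid_ge0_integral iidZ i (u := EFin \o I k)) => [|x].
      exact/measurable_EFinP.
    by rewrite lee_fin ler0n.
  under eq_bigr do rewrite E.
  by rewrite sumEFin sumr_const_nat subn0 RintegralZl// mulr_natl.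
apply: filterS2 Wlaw flaw => w /cvgr0Pnorm_lt Ww /cvgr0Pnorm_lt fw c cg.
rewrite (_ : c = 2 * (c / 2)); last by field.
apply: avg_le_dyadic => //.
have e0 : 0 < c / 2 - \int[theta]_x g x by lra.
apply: filterS2 (Ww _ e0) (fw _ ltr01) => k; rewrite ltr_norml => /andP[_ Wk].
rewrite ger0_norm; last by apply: sumr_ge0 => i _; exact: ler0n.
move=> fk.
have -> : avg g (Z ^~ w) (2 ^ k) = avg (W k) (Z ^~ w) (2 ^ k).
  rewrite /avg; congr (_ * _); apply: eq_bigr => i _; rewrite /W.
  case: leP => // gi; exfalso; move: fk; apply/negP; rewrite -leNgt /f big_mkord.
  by rewrite (bigD1 i)//= {1}/I gi lerDl sumr_ge0.
have : \int[theta]_x W k x <= \int[theta]_x g x.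
  by apply: le_Rintegral => // x _; rewrite /W; case: ifP => [//|_]; exact: g0.
lra.
Qed.

End laws_of_large_numbers.

(** * Statistics over all tuples and over injective tuples *)

Lemma ffact_ratio_cvg (R : realType) (m : nat) :
  (n ^_ m)%:R / n%:R ^+ m @[n --> \oo] --> (1 : R).
Proof.
elim: m => [|m IH].
  under eq_fun do rewrite expr0 ffactn0 divr1; exact: cvg_cst.
have step : (n - m)%:R / n%:R @[n --> \oo] --> (1 : R).
  apply/cvgrPdist_lt => e e0; exists (Num.truncn (m%:R / e) + m).+1 => // n /= mn.
  have nm : (m <= n)%N by rewrite (leq_trans _ mn)// leqW// leq_addl.
  have n0 : 0 < n%:R :> R by rewrite ltr0n (leq_trans _ mn).
  rewrite natrB// mulrBl mulfV ?gt_eqF// opprB addrCA subrr addr0.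
  rewrite ger0_norm ?divr_ge0// ltr_pdivrMr// mulrC -ltr_pdivrMr//.
  by rewrite (lt_le_trans (truncnS_gt _))// ler_nat (leq_trans _ mn)// ltnS leq_addr.
have H := cvgM IH step; rewrite mulr1 in H.
under eq_fun do rewrite ffactnSr natrM exprSr invfM mulrACA.
exact: H.
Qed.

Section statistics.
Context (R : realType) (T : Type) (m : nat) (z : nat -> T).
Implicit Types (k h : ('I_m -> T) -> R) (n : nat).

Local Notation V k n := (Vstat k (fun i : 'I_n => z i)).
Local Notation U k n := (Ustat k (fun i : 'I_n => z i)).

Lemma Vstat_sum (I : Type) (s : seq I) (F : I -> ('I_m -> T) -> R) n :
  V (fun t => \sum_(i <- s) F i t) n = \sum_(i <- s) V (F i) n.
Proof. by rewrite /Vstat exchange_big mulr_sumr. Qed.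

Lemma VstatZ (c : R) k n : V (fun t => c * k t) n = c * V k n.
Proof. by rewrite /Vstat -mulr_sumr mulrCA. Qed.

Lemma ler_dist_Vstat h k (Phi : ('I_m -> T) -> R) n :
  (forall t, `|h t - k t| <= Phi t) -> `|V h n - V k n| <= V Phi n.
Proof.
move=> hk; rewrite /Vstat -mulrBr -sumrB normrM ger0_norm ?invr_ge0 ?exprn_ge0//.
rewrite ler_wpM2l ?invr_ge0 ?exprn_ge0// (le_trans (ler_norm_sum _ _ _))//.
exact: ler_sum.
Qed.

(** Distributivity turns the product of the [m] averages into a sum over all tuples. *)
Lemma Vstat_prod (g : 'I_m -> T -> R) n :
  V (fun t => \prod_j g j (t j)) n = \prod_j avg (g j) z n.
Proof.
rewrite /avg big_split/= prodr_const card_ord exprVn bigA_distr_bigA.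
by [].
Qed.

Lemma avg1 n : (0 < n)%N -> avg (fun=> 1 : R) z n = 1.
Proof.
by move=> n0; rewrite /avg sumr_const card_ord mulVf// pnatr_eq0 -lt0n.
Qed.

Lemma Vstat_mul2 (i j : 'I_m) (u v : T -> R) n : (0 < n)%N -> i != j ->
  V (fun t => u (t i) * v (t j)) n = avg u z n * avg v z n.
Proof.
move=> n0 ij.
pose g l := if l == i then u else if l == j then v else fun=> 1.
transitivity (V (fun t => \prod_l g l (t l)) n).
  rewrite /Vstat; congr (_ * _); apply: eq_bigr => f _.
  rewrite (bigD1 i)//= (bigD1 j)/=; last by rewrite eq_sym.
  rewrite /g eqxx eq_sym (negbTE ij) eqxx big1 ?mulr1// => l /andP[li lj].
  by rewrite (negbTE li) (negbTE lj).
rewrite Vstat_prod (bigD1 i)//= (bigD1 j)/=; last by rewrite eq_sym.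
rewrite /g eqxx eq_sym (negbTE ij) eqxx big1 ?mulr1// => l /andP[li lj].
by rewrite (negbTE li) (negbTE lj) avg1.
Qed.

(** A kernel that depends on its arguments only through their cells is a linear
    combination of products of cell indicators. *)
Lemma Vstat_factor_cvg (C : finType) (kappa : T -> C) (p : C -> R)
    (G : {ffun 'I_m -> C} -> R) :
  (forall c, avg (fun x => (kappa x == c)%:R) z n @[n --> \oo] --> p c) ->
  V (fun t => G [ffun j => kappa (t j)]) n @[n --> \oo] -->
  \sum_c G c * \prod_j p (c j).
Proof.
move=> kp.
have E n : V (fun t => G [ffun j => kappa (t j)]) n =
    \sum_c G c * \prod_j avg (fun x => (kappa x == c j)%:R) z n.
  under eq_bigr do rewrite -Vstat_prod -VstatZ.
  rewrite -Vstat_sum /Vstat; congr (_ * _); apply: eq_bigr => f _.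
  rewrite (bigD1 [ffun j => kappa (z (f j))])//= big1 ?mulr1 ?addr0 => [|j _].
    rewrite big1 ?addr0// => c ck.
    have /forallPn[/= j cj] : ~~ [forall j, kappa (z (f j)) == c j].
      apply: contra ck => /forallP ck; apply/eqP/ffunP => j.
      by rewrite ffunE (eqP (ck j)).
    by rewrite (bigD1 j)//= (negbTE cj) mul0r mulr0.
  by rewrite ffunE eqxx.
under eq_fun do rewrite E.
apply: cvg_big => [|c _]; first exact: add_continuous.
apply: cvgM; first exact: cvg_cst.
apply: cvg_big => [|j _]; first exact: mul_continuous.
exact: kp.
Qed.

Lemma card_injective_ffun n :
  #|[pred f : {ffun 'I_m -> 'I_n} | injectiveb f]| = n ^_ m.
Proof. by have := card_inj_ffuns 'I_m 'I_n; rewrite !card_ord cardsE. Qed.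

(** A nonnegative kernel has a smaller sum over the injective tuples than over
    all tuples; only the normalisation differs. *)
Lemma ler_dist_Ustat h k (Phi : ('I_m -> T) -> R) n : (0 < n)%N ->
  (forall t, `|h t - k t| <= Phi t) ->
  `|U h n - U k n| <= ((n ^_ m)%:R / n%:R ^+ m)^-1 * V Phi n.
Proof.
move=> n0 hk; have Phi0 t : 0 <= Phi t by exact: le_trans (hk t).
rewrite /Ustat /Vstat -mulrBr -sumrB normrM ger0_norm ?invr_ge0//.
rewrite invfM invrK mulrA -(mulrA _ (n%:R ^+ m)) mulfV ?mulr1; last first.
  by rewrite expf_neq0// pnatr_eq0 -lt0n.
rewrite ler_wpM2l ?invr_ge0// (le_trans (ler_norm_sum _ _ _))//.
rewrite [leRHS](bigID (fun f : {ffun 'I_m -> 'I_n} => injectiveb f))/=.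
rewrite -[leLHS]addr0 lerD ?sumr_ge0//; exact: ler_sum.
Qed.

(** The factor [2 B] covers the discarded tuples and the change of normalisation
    of the others. *)
Lemma ler_dist_Ustat_Vstat k (B : R) n : (0 < n)%N -> (0 < n ^_ m)%N ->
  (forall t, `|k t| <= B) ->
  `|U k n - V k n| <= 2 * B * (1 - (n ^_ m)%:R / n%:R ^+ m).
Proof.
move=> n0 nm0 kB.
pose a : R := (n ^_ m)%:R; pose b : R := n%:R ^+ m.
have a0 : 0 < a by rewrite ltr0n.
have b0 : 0 < b by rewrite exprn_gt0// ltr0n.
pose S1 := \sum_(f : {ffun 'I_m -> 'I_n} | injectiveb f) k (fun j => z (f j)).
pose S2 := \sum_(f : {ffun 'I_m -> 'I_n} | ~~ injectiveb f) k (fun j => z (f j)).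
have cT : a + #|[pred f : {ffun 'I_m -> 'I_n} | ~~ injectiveb f]|%:R = b.
  rewrite /a -card_injective_ffun -natrD cardC card_ffun !card_ord natrX.
  by [].
have S1B : `|S1| <= B * a.
  rewrite /a -card_injective_ffun mulr_natr -sumr_const.
  by rewrite (le_trans (ler_norm_sum _ _ _))//; exact: ler_sum.
have S2B : `|S2| <= B * (b - a).
  rewrite -cT addrAC subrr add0r mulr_natr -sumr_const.
  by rewrite (le_trans (ler_norm_sum _ _ _))//; exact: ler_sum.
have -> : U k n - V k n = a^-1 * S1 - b^-1 * (S1 + S2).
  by rewrite /Ustat /Vstat [in X in _ - X](bigID (fun f : {ffun 'I_m -> 'I_n} => injectiveb f)).
rewrite -/a -/b.
have -> : a^-1 * S1 - b^-1 * (S1 + S2) = (S1 * (b - a) - a * S2) / (a * b).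
  by field; rewrite !gt_eqF.
rewrite normrM normfV (gtr0_norm (mulr_gt0 a0 b0)) ler_pdivrMr ?mulr_gt0//.
have ab : a <= b by rewrite -cT lerDl.
have -> : 2 * B * (1 - a / b) * (a * b) = B * a * (b - a) + a * (B * (b - a)).
  by field; rewrite gt_eqF.
rewrite (le_trans (ler_normB _ _))// lerD//.
  by rewrite normrM (ger0_norm (_ : 0 <= b - a)) ?subr_ge0// ler_wpM2r// subr_ge0.
by rewrite normrM (gtr0_norm a0) ler_pM2l.
Qed.

Section approximation.
Variables (h : ('I_m -> T) -> R) (hN Phi : nat -> ('I_m -> T) -> R).
Variables (B c LN : nat -> R) (L : R).
Hypotheses (h_hN : forall N t, `|h t - hN N t| <= Phi N t)
  (hNB : forall N t, `|hN N t| <= B N)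
  (V_hN : forall N, V (hN N) n @[n --> \oo] --> LN N)
  (V_Phi : forall N, \forall n \near \oo, V (Phi N) n <= c N)
  (c0 : c N @[N --> \oo] --> 0)
  (LNL : LN N @[N --> \oo] --> L).

Lemma approximation_index (e : R) : 0 < e ->
  exists N, c N < e /\ `|L - LN N| < e.
Proof.
move=> e0.
have /cvgr0Pnorm_lt/(_ _ e0) cN := c0.
have /cvgrPdist_lt/(_ _ e0) dN := LNL.
have [N _ /(_ N (leqnn N)) [cNe dNe]] : \forall N \near \oo, `|c N| < e /\ `|L - LN N| < e.
  exact: filterI.
by exists N; split => //; exact: le_lt_trans (ler_norm _) cNe.
Qed.

Lemma Vstat_cvg_approx : V h n @[n --> \oo] --> L.
Proof.
apply/cvgrPdist_lt => e e0.
have e30 : 0 < e / 3 by rewrite divr_gt0.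
have [N [cNe dNe]] := approximation_index e30.
have /cvgrPdist_lt/(_ _ e30) vN := @V_hN N.
apply: filterS2 (V_Phi N) vN => n Phin Vn.
have := ler_dist_Vstat n (h_hN N) => H.
rewrite (_ : L - _ = (L - LN N) + (LN N - V (hN N) n) - (V h n - V (hN N) n)).
  rewrite (le_lt_trans (ler_normB _ _))//.
  have := ler_normD (L - LN N) (LN N - V (hN N) n); lra.
by ring.
Qed.

Lemma Ustat_cvg_approx : U h n @[n --> \oo] --> L.
Proof.
apply/cvgrPdist_lt => e e0.
have e30 : 0 < e / 5 by rewrite divr_gt0.
have [N [cNe dNe]] := approximation_index e30.
have /cvgrPdist_lt/(_ _ e30) vN := @V_hN N.
have B0 : 0 <= B N by exact: le_trans (hNB N (fun=> z 0%N)).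
(* The ratio of injective tuples is taken above [1 / 2] so that normalising by
   their number at most doubles [Phi], and so close to [1] that the bounded
   quantity [2 * B N] times the defect is small; the [+ 1] avoids a division by
   zero. *)
have d0 : 0 < Num.min (1 / 2) (e / 5 / (2 * B N + 1)).
  by rewrite lt_min !divr_gt0// ltr_wpDl// mulr_ge0.
have /cvgrPdist_lt/(_ _ d0) rn := @ffact_ratio_cvg R m.
apply: filterS3 (V_Phi N) vN (filterI rn (nbhs_infty_gt m)) => n Phin Vn [+ mn].
have n0 : (0 < n)%N by rewrite (leq_ltn_trans _ mn).
have nm0 : (0 < n ^_ m)%N by rewrite ffact_gt0 ltnW.
have := ler_dist_Ustat n0 (h_hN N).
have := ler_dist_Ustat_Vstat n0 nm0 (hNB N).
have VP0 : 0 <= V (Phi N) n.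
  rewrite mulr_ge0 ?invr_ge0 ?exprn_ge0// sumr_ge0// => f _.
  exact: le_trans (h_hN N _).
set r := _ / _ => UV Uh.
rewrite lt_min => /andP[r1 rB].
have r2 : 1 / 2 <= r by have := ler_norm (1 - r); lra.
have r0 : 0 < r by lra.
have rV : r^-1 * V (Phi N) n <= 2 * (e / 5).
  rewrite (@le_trans _ _ (2 * V (Phi N) n))//; last lra.
  rewrite ler_wpM2r// -[2]invrK lef_pV2 ?posrE ?invr_gt0//; lra.
have rB2 : 2 * B N * (1 - r) <= e / 5.
  apply: (@le_trans _ _ ((2 * B N + 1) * `|1 - r|)).
    have := ler_norm (1 - r); have := normr_ge0 (1 - r); nra.
  by rewrite mulrC -ler_pdivlMr ?ltW// ltr_wpDl// mulr_ge0.
rewrite (_ : L - _ = (L - LN N) + (LN N - V (hN N) n) - (U h n - U (hN N) n)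
   - (U (hN N) n - V (hN N) n)); last by ring.
rewrite (le_lt_trans (ler_normB _ _))//.
have := ler_normB ((L - LN N) + (LN N - V (hN N) n)) (U h n - U (hN N) n).
have := ler_normD (L - LN N) (LN N - V (hN N) n); lra.
Qed.

End approximation.

End statistics.

(** * Sums over tuples of cells *)

Section six_fold_sum.
Context (R : realType) (C : finType) (p : C -> R).

Definition fcons (m : nat) (c : C) (g : {ffun 'I_m -> C}) : {ffun 'I_m.+1 -> C} :=
  [ffun i => oapp g c (unlift ord0 i)].

Lemma fcons0 m c (g : {ffun 'I_m -> C}) : fcons c g ord0 = c.
Proof. by rewrite ffunE unlift_none. Qed.

Lemma fconsS m c (g : {ffun 'I_m -> C}) i : fcons c g (lift ord0 i) = g i.
Proof. by rewrite ffunE liftK. Qed.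

Definition wsum (F : C -> R) : R := \sum_c p c * F c.

Lemma sum_ffunS m (F : {ffun 'I_m.+1 -> C} -> R) :
  \sum_f F f * \prod_j p (f j) =
  wsum (fun c => \sum_(g : {ffun 'I_m -> C}) F (fcons c g) * \prod_j p (g j)).
Proof.
rewrite /wsum; under [RHS]eq_bigr do rewrite mulr_sumr.
rewrite pair_big/= (reindex (fun x : C * {ffun 'I_m -> C} => fcons x.1 x.2))/=.
  apply: eq_bigr => -[c g] _ /=; rewrite big_ord_recl fcons0 mulrCA.
  by congr (_ * (_ * _)); apply: eq_bigr => i _; congr p; exact: fconsS.
exists (fun f => (f ord0, [ffun i => f (lift ord0 i)])) => [[c g] _|f _] /=.
  by rewrite fcons0; congr (_, _); apply/ffunP => i; rewrite ffunE fconsS.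
apply/ffunP => i; rewrite ffunE; case: unliftP => [j ->|->] //=.
by rewrite ffunE.
Qed.

Lemma sum_ffun0 (F : {ffun 'I_0 -> C} -> R) (a : R) : (forall f, F f = a) ->
  \sum_f F f * \prod_j p (f j) = a.
Proof.
move=> Fa; under eq_bigr do rewrite big_ord0 mulr1 Fa.
by rewrite sumr_const card_ffun card_ord expn0.
Qed.

Lemma eq_wsum F G : F =1 G -> wsum F = wsum G.
Proof. by move=> FG; apply: eq_bigr => c _; rewrite FG. Qed.

Lemma wsumMl a F : wsum (fun c => a * F c) = a * wsum F.
Proof. by rewrite /wsum mulr_sumr; apply: eq_bigr => c _; rewrite mulrCA. Qed.

Lemma wsumMr a F : wsum (fun c => F c * a) = wsum F * a.
Proof. by rewrite mulrC -wsumMl; apply: eq_wsum => c; rewrite mulrC. Qed.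

Lemma wsumD F G : wsum (fun c => F c + G c) = wsum F + wsum G.
Proof. by rewrite /wsum -big_split; apply: eq_bigr => c _; rewrite mulrDr. Qed.

Lemma wsumB F G : wsum (fun c => F c - G c) = wsum F - wsum G.
Proof. by rewrite /wsum -sumrB; apply: eq_bigr => c _; rewrite mulrBr. Qed.

Hypothesis p1 : \sum_c p c = 1.

Lemma wsum_cst a : wsum (fun=> a) = a.
Proof. by rewrite /wsum -mulr_suml p1 mul1r. Qed.

Definition fin_centred (d : C -> C -> R) (a b : C) : R :=
  d a b - wsum (d a) - wsum (d b) + wsum (fun c => wsum (d c)).

(** The shape of [f_kernel], for a function that need not be a distance: two cells
    may have the same projection to [X]. *)
Definition four_point (d : C -> C -> R) (a b c e : C) : R :=
  d a b - d a c - d b e + d c e.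

Lemma wsum_four_point d a b :
  wsum (fun c => wsum (fun e => four_point d a b c e)) = fin_centred d a b.
Proof.
rewrite /four_point /fin_centred.
under eq_wsum => c do rewrite wsumD wsumB wsum_cst.
by rewrite wsumD wsumB wsum_cst wsumB wsum_cst.
Qed.

(** Given the first two indices, the third and fourth are independent of the
    last two, so that averaging over the last four centres both factors. *)
Lemma six_fold_sum (dX dY : C -> C -> R) :
  \sum_(c : {ffun 'I_6 -> C})
    four_point dX (c 0) (c 1) (c 2) (c 3) *
    four_point dY (c 0) (c 1) (c 4) (c 5) * \prod_j p (c j) =
  wsum (fun a => wsum (fun b => fin_centred dX a b * fin_centred dY a b)).
Proof.
have E1 : 1 = lift ord0 ord0 :> 'I_6 by exact: val_inj.
have E2 : 2 = lift ord0 (lift ord0 ord0) :> 'I_6 by exact: val_inj.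
have E3 : 3 = lift ord0 (lift ord0 (lift ord0 ord0)) :> 'I_6 by exact: val_inj.
have E4 : 4 = lift ord0 (lift ord0 (lift ord0 (lift ord0 ord0))) :> 'I_6
  by exact: val_inj.
have E5 : 5 = lift ord0 (lift ord0 (lift ord0 (lift ord0 (lift ord0 ord0)))) :> 'I_6
  by exact: val_inj.
rewrite sum_ffunS; apply: eq_wsum => a.
rewrite sum_ffunS; apply: eq_wsum => b.
transitivity (wsum (fun c => wsum (fun e => wsum (fun c' => wsum (fun e' =>
  four_point dX a b c e * four_point dY a b c' e'))))).
  do 4 (rewrite sum_ffunS; apply: eq_wsum => ?).
  apply: sum_ffun0 => f.
  by rewrite E5 E4 E3 E2 E1 !(fconsS, fcons0).
rewrite -!wsum_four_point -wsumMr; apply: eq_wsum => c.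
rewrite -wsumMr; apply: eq_wsum => e.
rewrite -wsumMl; apply: eq_wsum => c'.
by rewrite -wsumMl.
Qed.

End six_fold_sum.

Section finite_valued.
Context d (T : measurableType d) (R : realType) (theta : probability T R).
Context (C : finType) (kappa : T -> C).
Hypothesis mkappa : forall c, measurable (kappa @^-1` [set c]).

Definition cell_mass (c : C) : R := \int[theta]_x (kappa x == c)%:R.

Lemma measurable_cell c :
  measurable_fun setT (fun x => (kappa x == c)%:R : R).
Proof.
rewrite (_ : (fun _ => _) = \1_(kappa @^-1` [set c])).
  exact: measurable_indic.
apply/funext => x; rewrite indicE; congr (nat_of_bool _)%:R.
by apply/eqP/idP; rewrite inE.
Qed.

Lemma integrable_cell c :
  theta.-integrable setT (EFin \o (fun x => (kappa x == c)%:R)).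
Proof.
apply: (@bounded_integrable _ _ _ _ _ 1); first exact: measurable_cell.
by move=> x; rewrite normr_nat lern1 leq_b1.
Qed.

Lemma cell_mass_measure c : (cell_mass c)%:E = theta (kappa @^-1` [set c]).
Proof.
rewrite /cell_mass -EFin_Rintegral; last exact: integrable_cell.
rewrite -[X in theta X]setIT -integral_indic//; apply: eq_integral => x _.
rewrite indicE; congr (nat_of_bool _)%:R%:E.
by apply/eqP/idP; rewrite inE.
Qed.

Lemma cell_decomposition (G : C -> R) x :
  G (kappa x) = \sum_c G c * (kappa x == c)%:R.
Proof.
rewrite (bigD1 (kappa x))//= eqxx mulr1 big1 ?addr0// => c /negbTE.
by rewrite eq_sym => ->; rewrite mulr0.
Qed.

Lemma measurable_factor (G : C -> R) : measurable_fun setT (fun x => G (kappa x)).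
Proof.
under eq_fun do rewrite cell_decomposition.
apply: measurable_sum => c; apply: measurable_funM => //; exact: measurable_cell.
Qed.

Lemma integrable_factor (G : C -> R) :
  theta.-integrable setT (EFin \o (fun x => G (kappa x))).
Proof.
apply: (@bounded_integrable _ _ _ _ _ (\sum_c `|G c|)).
  exact: measurable_factor.
by move=> x; rewrite (bigD1 (kappa x))//= lerDl sumr_ge0.
Qed.

Lemma Rintegral_factor (G : C -> R) :
  \int[theta]_x G (kappa x) = wsum cell_mass G.
Proof.
apply: EFin_inj; rewrite -EFin_Rintegral; last exact: integrable_factor.
under eq_integral do rewrite cell_decomposition -sumEFin.
rewrite integral_sum//; last by move=> c; exact: (integrableZl measurableT _ (integrable_cell c)).
rewrite /wsum -sumEFin; apply: eq_bigr => c _.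
rewrite mulrC EFinM -EFin_Rintegral; last exact: integrable_cell.
by rewrite -integralZl//; exact: integrable_cell.
Qed.

Lemma cell_mass_sum1 : \sum_c cell_mass c = 1.
Proof.
have th1 : fine (theta setT) = 1 by rewrite probability_setT.
have := Rintegral_factor (fun=> 1); rewrite Rintegral_cst// mul1r th1 => ->.
by apply: eq_bigr => c _; rewrite mulr1.
Qed.

End finite_valued.

Section finite_valued_pairs.
Context d (T : measurableType d) (R : realType) (theta : probability T R).
Context (C : finType) (kappa : T -> C).
Hypothesis mkappa : forall c, measurable (kappa @^-1` [set c]).

Definition kappa2 (z : T * T) : C * C := (kappa z.1, kappa z.2).

Lemma kappa2_preimage c :
  kappa2 @^-1` [set c] = kappa @^-1` [set c.1] `*` kappa @^-1` [set c.2].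
Proof.
by case: c => a b; apply/seteqP; split => -[x y] /=; rewrite /kappa2/= => -[-> ->].
Qed.

Lemma measurable_kappa2 c : measurable (kappa2 @^-1` [set c]).
Proof. by rewrite kappa2_preimage; apply: measurableX. Qed.

Lemma Rintegral_factor2 (G : C -> C -> R) :
  \int[(theta \x theta)%E]_z G (kappa z.1) (kappa z.2) =
  wsum (cell_mass theta kappa) (fun a => wsum (cell_mass theta kappa) (G a)).
Proof.
have := Rintegral_factor (theta \x theta)%E measurable_kappa2 (fun c => G c.1 c.2).
rewrite /kappa2/= => ->; rewrite /wsum.
under [RHS]eq_bigr do rewrite mulr_sumr.
rewrite pair_big/=; apply: eq_bigr => -[a b] _ /=; rewrite mulrA; congr (_ * _).
apply: EFin_inj; rewrite cell_mass_measure; last exact: measurable_kappa2.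
rewrite EFinM !cell_mass_measure// kappa2_preimage/=.
exact: product_measure1E.
Qed.

End finite_valued_pairs.

(** * Quantization of a separable metric space *)

Section lipschitz_measurability.
Context (R : realType) (X : pmetricType R).

Lemma measurable_lipschitz (f : X -> R) :
  (forall x y, `|f x - f y| <= mdist x y) ->
  measurable_fun [set: borel X] (f : borel X -> R).
Proof.
move=> fl; apply: (measurability _ (RGenOInfty.measurableE R)).
move=> _ [_ [a ->] <-]; rewrite setTI; apply: sub_sigma_algebra.
rewrite openE => x /=; rewrite in_itv/= andbT => ax.
apply/nbhs_ballP; exists (f x - a); first by rewrite /= subr_gt0.
move=> y; rewrite ballEmdist/= in_itv/= andbT => xy.
have := fl x y; have := ler_norm (f x - f y); lra.
Qed.

Lemma mdist_lipschitz (a x y : X) : `|mdist x a - mdist y a| <= mdist x y.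
Proof.
have := metric_triangle y x a; have := metric_triangle x y a.
rewrite (metric_sym y x) ler_norml => yxa xya.
by apply/andP; split; lra.
Qed.

Lemma measurable_mdist (a : X) :
  measurable_fun [set: borel X] (fun x : borel X => mdist (x : X) a).
Proof. by apply: measurable_lipschitz => x y; exact: mdist_lipschitz. Qed.

Lemma mdist_dist (x x' y y' : X) :
  `|mdist x y - mdist x' y'| <= mdist x x' + mdist y y'.
Proof.
rewrite (_ : _ - _ = (mdist x y - mdist x' y) + (mdist y x' - mdist y' x')).
  by rewrite (le_trans (ler_normD _ _))// lerD// mdist_lipschitz.
by rewrite (metric_sym y x') (metric_sym y' x'); ring.
Qed.

End lipschitz_measurability.

Section quantization.
Context (R : realType) (X : pmetricType R) (s : nat -> X).

(** The recursion on [N], which keeps the earlier point in case of a tie, lets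
    measurability be proved by induction. *)
Fixpoint nearest (x : X) (N : nat) : nat :=
  if N is N'.+1 then
    if mdist x (s N) < mdist x (s (nearest x N')) then N else nearest x N'
  else 0.

Definition quant (N : nat) (x : X) : X := s (nearest x N).

Definition qerr (N : nat) (x : X) : R := mdist x (quant N x).

Lemma nearest_le x N : (nearest x N <= N)%N.
Proof. by elim: N => //= N IH; case: ifP => // _; exact: leqW. Qed.

Lemma qerr_le x N k : (k <= N)%N -> qerr N x <= mdist x (s k).
Proof.
rewrite /qerr /quant; elim: N => [|N IH]; first by rewrite leqn0 => /eqP ->.
have [kN _|Nk kN] := leqP k N => /=.
  by case: ltP => [/ltW h|_]; [apply: (le_trans h)|]; exact: IH.
have -> : k = N.+1 by apply/eqP; rewrite eqn_leq kN.
by case: ltP.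
Qed.

Lemma qerr_ge0 N x : 0 <= qerr N x.
Proof. exact: mdist_ge0. Qed.

Lemma qerr_cvg0 : dense (range s) -> forall x, qerr N x @[N --> \oo] --> 0.
Proof.
move=> ds x; apply/cvgr0Pnorm_lt => e e0.
have [_ [/[swap] [[k _ <-]] xb]] := ds (ball x e)° (ex_intro _ x (nbhsx_ballx x e e0))
  (open_interior _).
have {}xb : mdist x (s k) < e by have := interior_subset xb; rewrite ballEmdist.
exists k => // N /= kN; rewrite ger0_norm ?qerr_ge0//.
by apply: le_lt_trans xb; exact: qerr_le.
Qed.

Lemma measurable_qerr N :
  measurable_fun [set: borel X] (fun x : borel X => qerr N x).
Proof.
rewrite /qerr /quant; elim: N => [|N IH] /=; first exact: measurable_mdist.
rewrite (_ : (fun _ => _) = fun x : borel X =>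
    if mdist x (s N.+1) < mdist x (s (nearest x N)) then mdist x (s N.+1)
    else mdist x (s (nearest x N))); last by apply/funext => x; case: ifP.
apply: measurable_fun_ifT => //; last exact: measurable_mdist.
by apply: measurable_fun_ltr => //; exact: measurable_mdist.
Qed.

Lemma measurable_nearest N k :
  measurable ((fun x : borel X => nearest x N) @^-1` [set k]).
Proof.
elim: N => [|N IH] /=.
  have [->|k0] := eqVneq k 0%N.
    by rewrite (_ : _ @^-1` _ = setT)//; apply/seteqP; split.
  rewrite (_ : _ @^-1` _ = set0)//; apply/seteqP; split=> // x /= /esym/eqP.
  by rewrite (negbTE k0).
pose A := [set x : borel X | mdist (x : X) (s N.+1) < mdist (x : X) (s (nearest x N))].
have mA : measurable A.
  pose b (x : borel X) := mdist (x : X) (s N.+1) < qerr N x.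
  have mb : measurable_fun [set: borel X] b.
    by apply: measurable_fun_ltr; [exact: measurable_mdist|exact: measurable_qerr].
  have -> : A = setT `&` b @^-1` [set true] by rewrite setTI; apply/seteqP; split.
  exact: mb.
have [kN|kN] := eqVneq k N.+1.
  rewrite (_ : _ @^-1` _ = A)//; apply/seteqP; rewrite kN; split => x /=.
    rewrite /A/=; case: ifP => [//|_ xN].
    by have := nearest_le x N; rewrite xN ltnn.
  by rewrite /A/= => ->.
rewrite (_ : _ @^-1` _ = (fun x : borel X => nearest x N) @^-1` [set k] `\` A).
  exact: measurableD.
apply/seteqP; split => x /=; rewrite /A/=.
  by case: ifP => // _ Nk; move: kN; rewrite -Nk eqxx.
by case=> xk /negP/negbTE ->.
Qed.

(** The base point [s 0] is one of the candidates, so quantization moves a point at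
    most as far as the base point is. *)
Lemma quant_base_le N x : mdist (quant N x) (s 0%N) <= 2 * qerr 0 x.
Proof.
have := metric_triangle (quant N x) x (s 0%N).
have := qerr_le x (leq0n N).
rewrite /qerr (metric_sym (quant N x) x) /quant /=; lra.
Qed.

Lemma quant_mdist_le N x y :
  mdist (quant N x) (quant N y) <= 2 * qerr 0 x + 2 * qerr 0 y.
Proof.
have := metric_triangle (quant N x) (s 0%N) (quant N y).
have := quant_base_le N x; have := quant_base_le N y.
rewrite (metric_sym (s 0%N)); lra.
Qed.

Lemma mdist_base_le x y : mdist x y <= qerr 0 x + qerr 0 y.
Proof. by rewrite /qerr /quant/= (metric_sym y) metric_triangle. Qed.

End quantization.

(** * Double centring *)

Section centring.
Context d (T : measurableType d) (R : realType) (theta : probability T R).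

Lemma dist_Rintegral (f g h : T -> R) :
  theta.-integrable setT (EFin \o f) -> theta.-integrable setT (EFin \o g) ->
  theta.-integrable setT (EFin \o h) -> (forall x, `|f x - g x| <= h x) ->
  `|\int[theta]_x f x - \int[theta]_x g x| <= \int[theta]_x h x.
Proof.
move=> fi gi hi fgh; rewrite -RintegralB//.
have fgi : theta.-integrable setT (EFin \o (fun x => f x - g x)).
  exact: (integrableB measurableT fi gi).
rewrite (le_trans (le_normr_Rintegral _ _))// le_Rintegral//.
exact: (integrable_norm fgi).
Qed.

Lemma integrable_const (c : R) : theta.-integrable setT (EFin \o (fun _ : T => c)).
Proof. exact: (@bounded_integrable _ _ _ _ _ `|c|). Qed.

Lemma Rintegral_const (c : R) : \int[theta]_x c = c.
Proof.
have th1 : fine (theta setT) = 1 by rewrite probability_setT.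
by rewrite Rintegral_cst// th1 mulr1.
Qed.

Definition centred (delta : T -> T -> R) (z w : T) : R :=
  delta z w - \int[theta]_v delta z v - \int[theta]_v delta w v +
  \int[theta]_u (\int[theta]_v delta u v).

(** On a map with finitely many values, centring with respect to [theta] is centring
    with respect to the cell masses. *)
Lemma centred_factor (C : finType) (kappa : T -> C) (dd : C -> C -> R) z w :
  (forall c, measurable (kappa @^-1` [set c])) ->
  centred (fun z w => dd (kappa z) (kappa w)) z w =
  fin_centred (cell_mass theta kappa) dd (kappa z) (kappa w).
Proof.
move=> mk; rewrite /centred /fin_centred !(Rintegral_factor theta mk).
under eq_Rintegral do rewrite (Rintegral_factor theta mk).
by rewrite (Rintegral_factor theta mk (fun c => wsum _ (dd c))).
Qed.

Lemma centred_sym delta z w : (forall z w, delta z w = delta w z) ->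
  centred delta z w = centred delta w z.
Proof. by move=> ds; rewrite /centred ds; ring. Qed.

(** Centring once turns [delta z w] into the mean over [v] of
    [delta z w - delta z v], which the triangle inequality bounds by [delta w v];
    centring a second time subtracts the mean of this over [z], which has the same
    bound. *)
Lemma centred_bound delta z w :
  (forall z w, delta z w = delta w z) ->
  (forall u v z, delta u z <= delta u v + delta v z) ->
  (forall z, theta.-integrable setT (EFin \o delta z)) ->
  theta.-integrable setT (EFin \o (fun z => \int[theta]_v delta z v)) ->
  `|centred delta z w| <= 2 * \int[theta]_v delta w v.
Proof.
move=> ds dt di dii.
have dd u v x : `|delta u x - delta v x| <= delta u v.
  have := dt u v x; have := dt v u x; rewrite (ds v u) ler_norml => h1 h2.
  by apply/andP; split; lra.
have H1 : `|delta z w - \int[theta]_v delta z v| <= \int[theta]_v delta w v.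
  rewrite -[X in X - _]Rintegral_const dist_Rintegral//.
    exact: integrable_const.
  by move=> x; rewrite (ds z w) (ds z x).
have H2 : `|\int[theta]_u (\int[theta]_v delta u v) - \int[theta]_v delta w v|
    <= \int[theta]_v delta w v.
  rewrite -[X in _ - X]Rintegral_const dist_Rintegral//.
    exact: integrable_const.
  move=> x; rewrite (ds w x) -[leRHS]Rintegral_const dist_Rintegral//.
  exact: integrable_const.
rewrite /centred -addrA [X in `|_ + X|]addrC (le_trans (ler_normD _ _))//.
by rewrite mulrDl mul1r lerD.
Qed.

(** Each of the four terms of a centred distance moves by at most the errors of
    its arguments, integrated where the argument is. *)
Lemma centred_dist (delta delta' : T -> T -> R) (e : T -> R) z w :
  (forall z, theta.-integrable setT (EFin \o delta z)) ->
  theta.-integrable setT (EFin \o (fun z => \int[theta]_v delta z v)) ->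
  (forall z, theta.-integrable setT (EFin \o delta' z)) ->
  theta.-integrable setT (EFin \o (fun z => \int[theta]_v delta' z v)) ->
  theta.-integrable setT (EFin \o e) ->
  (forall z w, `|delta z w - delta' z w| <= e z + e w) ->
  `|centred delta z w - centred delta' z w| <=
  2 * (e z + e w + 2 * \int[theta]_v e v).
Proof.
move=> di dii di' dii' ei dd; set E := \int[theta]_v e v.
have H1 u : `|\int[theta]_v delta u v - \int[theta]_v delta' u v| <= e u + E.
  have -> : e u + E = \int[theta]_v (e u + e v).
    by rewrite RintegralD ?Rintegral_const//; exact: integrable_const.
  rewrite dist_Rintegral//.
  exact: (integrableD measurableT (integrable_const _) ei).
have H2 : `|\int[theta]_u (\int[theta]_v delta u v) -
    \int[theta]_u (\int[theta]_v delta' u v)| <= E + E.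
  have -> : E + E = \int[theta]_v (e v + E).
    by rewrite RintegralD ?Rintegral_const//; exact: integrable_const.
  rewrite dist_Rintegral//.
  exact: (integrableD measurableT ei (integrable_const _)).
have := dd z w; have := H1 z; have := H1 w; move: H2; rewrite /centred.
do 6 (move: (Rintegral _ _ _) => ?); move: (e z) (e w) => ? ?.
rewrite !ler_norml => /andP[? ?] /andP[? ?] /andP[? ?] /andP[? ?].
by apply/andP; split; lra.
Qed.

End centring.

(** The law on [X] is kept as the image of [theta] under [pi], so that both factors
    of a product space are treated on the same probability space. *)
Section projected_quantization.
Context d (T : measurableType d) (R : realType) (theta : probability T R).
Context (X : pmetricType R) (s : nat -> X) (pi : T -> X).
Hypothesis mpi : measurable_fun setT (pi : T -> borel X).
Hypothesis moment : (\int[theta]_z (mdist (pi z) (s 0%N))%:E < +oo)%E.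

Local Notation delta := (fun z w => mdist (pi z) (pi w)).
Local Notation deltaN N := (fun z w => mdist (quant s N (pi z)) (quant s N (pi w))).
Local Notation a := (fun z => mdist (pi z) (s 0%N)).
Local Notation err N := (fun z => qerr s N (pi z)).

Lemma integrable_base : theta.-integrable setT (EFin \o a).
Proof.
apply/integrableP; split.
  apply/measurable_EFinP.
  exact: (measurableT_comp (@measurable_mdist _ X (s 0%N)) mpi).
by under eq_integral do rewrite /= ger0_norm ?mdist_ge0//.
Qed.

Lemma integrable_qerr N : theta.-integrable setT (EFin \o err N).
Proof.
apply: (le_integrable _ _ _ integrable_base) => //.
  apply/measurable_EFinP; exact: (measurableT_comp (measurable_qerr s N) mpi).
by move=> z _; rewrite /= lee_fin !ger0_norm ?mdist_ge0// qerr_le.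
Qed.

Lemma Rintegral_qerr_cvg0 : dense (range s) ->
  \int[theta]_z err N z @[N --> \oo] --> 0.
Proof.
move=> ds.
have [] := @dominated_convergence _ _ _ theta _ measurableT
  (fun N => EFin \o err N) (cst 0%E) (EFin \o a).
- by move=> N; exact: (measurable_int _ (integrable_qerr N)).
- exact: measurable_cst.
- by apply: aeW => z _; apply: cvg_EFin; [exact: nearW|exact: qerr_cvg0].
- exact: integrable_base.
- by apply: aeW => z N _; rewrite /= lee_fin ger0_norm ?mdist_ge0// qerr_le.
move=> _ _; rewrite integral0 => /fine_cvgP[_].
by apply.
Qed.

Lemma integrable_mdist (x : X) :
  theta.-integrable setT (EFin \o (fun w => mdist x (pi w))).
Proof.
have i2 : theta.-integrable setT (EFin \o (fun w => mdist x (s 0%N) + a w)).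
  exact: (integrableD measurableT (integrable_const _ _) integrable_base).
apply: (le_integrable _ _ _ i2) => //.
  apply/measurable_EFinP; rewrite (_ : (fun _ => _) = fun w => mdist (pi w) x).
    exact: (measurableT_comp (@measurable_mdist _ X x) mpi).
  by apply/funext => w; rewrite metric_sym.
move=> w _; rewrite /= lee_fin !ger0_norm ?mdist_ge0 ?addr_ge0 ?mdist_ge0//.
by rewrite (metric_sym (pi w)) metric_triangle.
Qed.

Lemma mean_mdist_lipschitz (x y : X) :
  `|\int[theta]_w mdist x (pi w) - \int[theta]_w mdist y (pi w)| <= mdist x y.
Proof.
rewrite -[leRHS](Rintegral_const theta).
apply: dist_Rintegral; [exact: integrable_mdist|exact: integrable_mdist|
  exact: integrable_const|].
by move=> w; exact: mdist_lipschitz.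
Qed.

Lemma integrable_mean_mdist :
  theta.-integrable setT (EFin \o (fun z => \int[theta]_w delta z w)).
Proof.
have i2 : theta.-integrable setT (EFin \o (fun z => a z + \int[theta]_w a w)).
  exact: (integrableD measurableT integrable_base (integrable_const _ _)).
apply: (le_integrable _ _ _ i2) => //.
  apply/measurable_EFinP.
  exact: (measurableT_comp (measurable_lipschitz mean_mdist_lipschitz) mpi).
move=> z _ /=; have A0 : 0 <= \int[theta]_w a w.
  by apply: Rintegral_ge0 => w _; exact: mdist_ge0.
rewrite lee_fin !ger0_norm ?addr_ge0 ?mdist_ge0//; last first.
  by apply: Rintegral_ge0 => w _; exact: mdist_ge0.
have -> : mdist (pi z) (s 0%N) + \int[theta]_w a w =
    \int[theta]_w (mdist (pi z) (s 0%N) + a w).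
  rewrite RintegralD ?Rintegral_const//; first exact: integrable_const.
  exact: integrable_base.
apply: le_Rintegral => //; first exact: integrable_mdist.
  exact: (integrableD measurableT (integrable_const _ _) integrable_base).
by move=> w _; rewrite (metric_sym (pi w)) metric_triangle.
Qed.

Definition cell (N : nat) (z : T) : 'I_N.+1 := inord (nearest s (pi z) N).

Lemma cellK N z : s (cell N z) = quant s N (pi z).
Proof. by rewrite /cell inordK// ltnS nearest_le. Qed.

Lemma measurable_cell_preimage N c : measurable (cell N @^-1` [set c]).
Proof.
have := mpi measurableT (measurable_nearest s N c); rewrite setTI.
congr measurable; apply/seteqP; split => z /=; rewrite /cell.
  by move=> E; apply/val_inj; rewrite /= inordK E.
by move=> <-; rewrite inordK// ltnS nearest_le.
Qed.

Lemma integrable_deltaN N z : theta.-integrable setT (EFin \o deltaN N z).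
Proof.
have := integrable_factor theta (@measurable_cell_preimage N)
  (fun c => mdist (quant s N (pi z)) (s c)).
by under eq_fun do rewrite cellK.
Qed.

Lemma integrable_mean_deltaN N :
  theta.-integrable setT (EFin \o (fun z => \int[theta]_w deltaN N z w)).
Proof.
have := integrable_factor theta (@measurable_cell_preimage N)
  (fun c => \int[theta]_w mdist (s c) (quant s N (pi w))).
by under eq_fun do rewrite cellK.
Qed.

Lemma centred_deltaN_cvg z w : dense (range s) ->
  centred theta (deltaN N) z w @[N --> \oo] --> centred theta delta z w.
Proof.
move=> ds.
apply/cvgrPdist_lt => eps eps0.
have bnd N := @centred_dist _ _ _ theta delta (deltaN N) (err N) z w
  (fun z => integrable_mdist (pi z)) integrable_mean_mdist
  (@integrable_deltaN N) (@integrable_mean_deltaN N) (@integrable_qerr N)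
  (fun z w => mdist_dist _ _ _ _).
have B0 : 2 * (err N z + err N w + 2 * \int[theta]_v err N v) @[N --> \oo] --> (0 : R).
  rewrite -[X in _ --> X](_ : 2 * (0 + 0 + 2 * 0) = 0); last by lra.
  apply: cvgMl_tmp; apply: cvgD.
    by apply: cvgD; exact: qerr_cvg0.
  by apply: cvgMl_tmp; exact: Rintegral_qerr_cvg0.
have /cvgr0Pnorm_lt/(_ _ eps0) := B0; apply: filterS => N h.
apply: le_lt_trans (bnd N) _; exact: le_lt_trans (ler_norm _) h.
Qed.

Lemma centred_deltaN_bound N z w :
  `|centred theta (deltaN N) z w| <= 4 * (a w + \int[theta]_v a v).
Proof.
apply: le_trans (centred_bound _ _ _ _ _ _) _.
- by move=> u v; rewrite metric_sym.
- by move=> u v x; exact: metric_triangle.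
- exact: integrable_deltaN.
- exact: integrable_mean_deltaN.
have i2a : theta.-integrable setT (EFin \o (fun v => 2 * a v)).
  exact: (integrableZl measurableT _ integrable_base).
have : \int[theta]_v deltaN N w v <= \int[theta]_v (2 * a w + 2 * a v).
  apply: le_Rintegral => //; first exact: integrable_deltaN.
    exact: (integrableD measurableT (integrable_const _ _) i2a).
  by move=> v _; exact: quant_mdist_le.
rewrite RintegralD ?Rintegral_const//; last exact: integrable_const.
rewrite RintegralZl//; last exact: integrable_base.
lra.
Qed.

End projected_quantization.

(** * Distance covariance *)

Section dense_sequence.
Context (R : realType) (X : pmetricType R).

(** The base point comes first, and unused codes of the countable set are sent
    to it. *)
Lemma separable_dense_sequence (o : X) : separable X ->
  exists2 s : nat -> X, s 0%N = o & dense (range s).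
Proof.
case=> D /countable_injP[f finj] dD.
pose s k := if k is k'.+1 then xget o [set x | D x /\ f x = k'] else o.
exists s => // O O0 oO; have [x [Ox Dx]] := dD O O0 oO.
exists x; split => //; exists (f x).+1 => //=.
case: xgetP => [y _ [Dy fy]|/(_ x)]; last by case.
by apply: finj => //; rewrite inE.
Qed.

End dense_sequence.

Lemma measurable_mdistr (R : realType) (X : pmetricType R) (x : X) :
  measurable_fun [set: borel X] (fun y : borel X => mdist x (y : X)).
Proof.
apply: measurable_lipschitz => y y'.
by rewrite !(metric_sym x) mdist_lipschitz.
Qed.

Lemma integrable_mul_prod d (T : measurableType d) (R : realType)
    (theta : probability T R) (u v : T -> R) :
  theta.-integrable setT (EFin \o u) -> theta.-integrable setT (EFin \o v) ->
  (theta \x theta)%E.-integrable setT (EFin \o (fun z => u z.1 * v z.2)).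
Proof.
move=> iu iv.
have mu : measurable_fun setT u by exact/measurable_EFinP/(measurable_int _ iu).
have mv : measurable_fun setT v by exact/measurable_EFinP/(measurable_int _ iv).
apply/integrable12ltyP.
  apply/measurable_EFinP/measurable_funM; exact: measurableT_comp.
have iv' := integrable_norm iv; have iu' := integrable_norm iu.
pose c := \int[theta]_y `|v y|.
have icu : theta.-integrable setT (fun x => c%:E * (`|u x|)%:E)%E.
  exact: (integrableZl measurableT c iu').
rewrite (eq_integral (fun x => c%:E * (`|u x|)%:E)%E); first exact: integrable_lty.
move=> x _; rewrite muleC /c -EFin_Rintegral//= -integralZl//.
by apply: eq_integral => y _; rewrite normrM EFinM.
Qed.

Lemma Rintegral_distribution d d' (U : measurableType d) (V : measurableType d')
    (R : realType) (P : probability U R) (f : {mfun U >-> V}) (g : V -> R) :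
  measurable_fun setT g -> (forall v, 0 <= g v) ->
  \int[distribution P f]_v g v = \int[P]_u g (f u).
Proof.
move=> mg g0; rewrite /Rintegral; congr fine.
rewrite ge0_integral_pushforward//; first exact/measurable_EFinP.
by move=> v _; rewrite lee_fin.
Qed.

Lemma d_mu_distribution d (T : measurableType d) (R : realType)
    (theta : probability T R) (X : pmetricType R) (pi : {mfun T >-> borel X})
    (o : X) : (\int[theta]_z (mdist (pi z : X) o)%:E < +oo)%E ->
  forall z w, d_mu (distribution theta pi) (pi z) (pi w) =
    centred theta (fun z w => mdist (pi z : X) (pi w)) z w.
Proof.
move=> moment z w.
have mpi : measurable_fun setT (pi : T -> borel X) by [].
have aE x : a_mu (distribution theta pi) x = \int[theta]_w mdist x (pi w : X).
  rewrite /a_mu Rintegral_distribution => [//||v]; first exact: measurable_mdistr.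
  exact: mdist_ge0.
rewrite /d_mu /centred !aE; congr (_ + _); rewrite /D_mu.
rewrite Rintegral_distribution; first by under eq_Rintegral do rewrite aE.
  apply: measurable_lipschitz => x y; rewrite !aE.
  exact: (mean_mdist_lipschitz (s := fun=> o) mpi moment).
by move=> v; rewrite aE; apply: Rintegral_ge0 => u _; exact: mdist_ge0.
Qed.

Section kernel_bounds.
Context (R : realType) (X : pmetricType R).
Implicit Types x y : X.

(** [d(x1, x2) - d(x1, x3)] and [d(x4, x3) - d(x4, x2)] are both at most
    [d(x2, x3)]. *)
Lemma f_kernel_bound23 x1 x2 x3 x4 : `|f_kernel x1 x2 x3 x4| <= 2 * mdist x2 x3.
Proof.
have := mdist_lipschitz x1 x2 x3; have := mdist_lipschitz x4 x2 x3.
rewrite !(metric_sym _ x1) /f_kernel !ler_norml => /andP[? ?] /andP[? ?].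
by apply/andP; split; lra.
Qed.

(** The same with the terms paired off as [d(x2, x1) - d(x2, x4)] and
    [d(x3, x4) - d(x3, x1)]. *)
Lemma f_kernel_bound14 x1 x2 x3 x4 : `|f_kernel x1 x2 x3 x4| <= 2 * mdist x1 x4.
Proof.
have := mdist_lipschitz x2 x1 x4; have := mdist_lipschitz x3 x1 x4.
rewrite (metric_sym x4 x2) (metric_sym x4 x3) /f_kernel !ler_norml.
by move=> /andP[? ?] /andP[? ?]; apply/andP; split; lra.
Qed.

Lemma f_kernel_dist x1 x2 x3 x4 y1 y2 y3 y4 :
  `|f_kernel x1 x2 x3 x4 - f_kernel y1 y2 y3 y4| <=
  2 * (mdist x1 y1 + mdist x2 y2 + mdist x3 y3 + mdist x4 y4).
Proof.
have := mdist_dist x1 y1 x2 y2; have := mdist_dist x1 y1 x3 y3.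
have := mdist_dist x2 y2 x4 y4; have := mdist_dist x3 y3 x4 y4.
rewrite /f_kernel !ler_norml.
move=> /andP[? ?] /andP[? ?] /andP[? ?] /andP[? ?].
by apply/andP; split; lra.
Qed.

End kernel_bounds.

Lemma dist_mul (R : realType) (a a' b b' : R) :
  `|a * b - a' * b'| <= `|a - a'| * `|b| + `|a'| * `|b - b'|.
Proof.
rewrite (_ : _ - _ = (a - a') * b + a' * (b - b')); last by ring.
by rewrite (le_trans (ler_normD _ _))// !normrM.
Qed.

Section distance_covariance_limit.
Context (R : realType) (X Y : pmetricType R).
Variable theta : probability (borel X * borel Y)%type R.
Variables (sX : nat -> X) (sY : nat -> Y).
Hypotheses (dX : dense (range sX)) (dY : dense (range sY)).
Local Notation T := (borel X * borel Y)%type.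
Hypothesis momentX : (\int[theta]_z (mdist (z.1 : X) (sX 0%N))%:E < +oo)%E.
Hypothesis momentY : (\int[theta]_z (mdist (z.2 : Y) (sY 0%N))%:E < +oo)%E.

Local Notation piX := (fun z : T => z.1 : X).
Local Notation piY := (fun z : T => z.2 : Y).

Let mX : measurable_fun setT (piX : T -> borel X).
Proof. exact: measurable_fst. Qed.
Let mY : measurable_fun setT (piY : T -> borel Y).
Proof. exact: measurable_snd. Qed.

Local Notation cX := (centred theta (fun z w => mdist (piX z) (piX w))).
Local Notation cY := (centred theta (fun z w => mdist (piY z) (piY w))).
Local Notation cXN N := (centred theta
  (fun z w => mdist (quant sX N (piX z)) (quant sX N (piX w)))).
Local Notation cYN N := (centred theta
  (fun z w => mdist (quant sY N (piY z)) (quant sY N (piY w)))).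

Definition cell2 (N : nat) (z : T) : 'I_N.+1 * 'I_N.+1 :=
  (cell sX piX N z, cell sY piY N z).

Lemma measurable_cell2_preimage N c : measurable (cell2 N @^-1` [set c]).
Proof.
rewrite (_ : _ @^-1` _ =
    cell sX piX N @^-1` [set c.1] `&` cell sY piY N @^-1` [set c.2]).
  by apply: measurableI; exact: measurable_cell_preimage.
by case: c => a b; apply/seteqP; split => z /=; rewrite /cell2 => -[-> ->].
Qed.

Definition quant_distX N (c c' : 'I_N.+1 * 'I_N.+1) := mdist (sX c.1) (sX c'.1).
Definition quant_distY N (c c' : 'I_N.+1 * 'I_N.+1) := mdist (sY c.2) (sY c'.2).

Definition quant_kernel N (c : {ffun 'I_6 -> 'I_N.+1 * 'I_N.+1}) : R :=
  four_point (@quant_distX N) (c 0) (c 1) (c 2) (c 3) *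
  four_point (@quant_distY N) (c 0) (c 1) (c 4) (c 5).

Definition quant_dcov N : R :=
  \sum_c quant_kernel c * \prod_j cell_mass theta (cell2 N) (c j).

Lemma centred_cell2 N z w : cXN N z w * cYN N z w =
  fin_centred (cell_mass theta (cell2 N)) (@quant_distX N) (cell2 N z) (cell2 N w) *
  fin_centred (cell_mass theta (cell2 N)) (@quant_distY N) (cell2 N z) (cell2 N w).
Proof.
have mk := @measurable_cell2_preimage N.
congr (_ * _).
  rewrite -(@centred_factor _ _ _ theta _ (cell2 N) (@quant_distX N) z w mk).
  congr (centred theta _ z w); apply/funext => u; apply/funext => v.
  by rewrite /quant_distX /= !cellK.
rewrite -(@centred_factor _ _ _ theta _ (cell2 N) (@quant_distY N) z w mk).
congr (centred theta _ z w); apply/funext => u; apply/funext => v.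
by rewrite /quant_distY /= !cellK.
Qed.

(** The polynomial limit of the quantized statistics is again an integral over two
    independent observations. *)
Lemma quant_dcovE N :
  quant_dcov N = \int[(theta \x theta)%E]_z (cXN N z.1 z.2 * cYN N z.1 z.2).
Proof.
have m2 := @measurable_cell2_preimage N.
rewrite /quant_dcov six_fold_sum; last exact: cell_mass_sum1.
rewrite -(Rintegral_factor2 theta m2).
by apply: eq_Rintegral => -[z w] _; rewrite centred_cell2.
Qed.

(** The factor over [X] is bounded through the second observation and the factor
    over [Y] through the first, so that the dominating function is a product of
    integrable functions of independent observations. *)
Lemma quant_dcov_cvg : quant_dcov N @[N --> \oo] --> dcov theta.
Proof.
pose A := \int[theta]_z mdist (piX z) (sX 0%N).
pose B := \int[theta]_z mdist (piY z) (sY 0%N).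
pose f N (z : T * T) := cXN N z.1 z.2 * cYN N z.1 z.2.
pose g (z : T * T) := 4 * (mdist (piX z.2) (sX 0%N) + A) *
  (4 * (mdist (piY z.1) (sY 0%N) + B)).
have mf N : measurable_fun setT (f N).
  pose G (c : ('I_N.+1 * 'I_N.+1) * ('I_N.+1 * 'I_N.+1)) : R :=
    fin_centred (cell_mass theta (cell2 N)) (@quant_distX N) c.1 c.2 *
    fin_centred (cell_mass theta (cell2 N)) (@quant_distY N) c.1 c.2.
  have -> : f N = fun z => G (kappa2 (cell2 N) z).
    by apply/funext => z; rewrite /f centred_cell2.
  exact: (measurable_factor (measurable_kappa2 (@measurable_cell2_preimage N)) G).
have f_cvg z : f N z @[N --> \oo] --> cX z.1 z.2 * cY z.1 z.2.
  by apply: cvgM; exact: centred_deltaN_cvg.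
have fg N z : `|f N z| <= g z.
  rewrite /f normrM /g ler_pM//; first exact: centred_deltaN_bound.
  rewrite centred_sym; first exact: centred_deltaN_bound.
  by move=> u v; rewrite metric_sym.
have gi : (theta \x theta)%E.-integrable setT (EFin \o g).
  rewrite (_ : EFin \o g = EFin \o (fun z =>
      (4 * (mdist (piY z.1) (sY 0%N) + B)) * (4 * (mdist (piX z.2) (sX 0%N) + A)))).
    apply: (integrable_mul_prod (u := fun z => 4 * (mdist (piY z) (sY 0%N) + B))
      (v := fun z => 4 * (mdist (piX z) (sX 0%N) + A))).
      have iB := integrableD measurableT (integrable_base mY momentY)
        (integrable_const theta B).
      exact: (integrableZl measurableT 4 iB).
    have iA := integrableD measurableT (integrable_base mX momentX)
      (integrable_const theta A).
    exact: (integrableZl measurableT 4 iA).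
  by apply/funext => z /=; rewrite /g mulrC.
have [] := @dominated_convergence _ _ _ (theta \x theta)%E _ measurableT
  (fun N => EFin \o f N) (fun z => (cX z.1 z.2 * cY z.1 z.2)%:E) (EFin \o g).
- by move=> N; exact/measurable_EFinP.
(* Joint measurability in the two observations comes from the approximation:
   each [f N] depends only on finitely many measurable cells. *)
- apply/measurable_EFinP; apply: (measurable_fun_cvg mf) => z _; exact: f_cvg.
- by apply: aeW => z _; apply: cvg_EFin; [exact: nearW|exact: f_cvg].
- exact: gi.
- by apply: aeW => z N _; rewrite /= lee_fin; exact: fg.
move=> fi _ /=.
rewrite -[X in _ --> X]fineK; last exact: integrable_fin_num fi.
move=> /fine_cvgP[_].
rewrite (_ : fine _ = dcov theta); last first.
  by apply: eq_Rintegral => z _; rewrite -(d_mu_distribution momentX) -(d_mu_distribution momentY).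
apply: cvg_trans; apply: near_eq_cvg; apply: nearW => N.
by rewrite quant_dcovE.
Qed.

Local Notation eX N := (fun z : T => qerr sX N (piX z)).
Local Notation eY N := (fun z : T => qerr sY N (piY z)).

(** A pair [(i, j)] stands for the product of the quantization error of [x_i] and
    the distance of [y_j] to the base point: errors at [0] meet the bound of the
    factor over [Y] by [d(y_1, y_4)], all others the bound by [d(y_0, y_5)]. *)
Definition index_pairsX : seq ('I_6 * 'I_6) :=
  [:: (0, 1); (0, 4); (1, 0); (1, 5); (2, 0); (2, 5); (3, 0); (3, 5)].

(** Likewise for the errors of [y_i]: those at [0] meet the bound by
    [d(x_1, x_2)], all others the bound by [d(x_0, x_3)]. *)
Definition index_pairsY : seq ('I_6 * 'I_6) :=
  [:: (0, 1); (0, 2); (1, 0); (1, 3); (4, 0); (4, 3); (5, 0); (5, 3)].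

Definition quant_error (N : nat) (t : 'I_6 -> T) : R :=
  \sum_(q <- index_pairsX) 4 * (eX N (t q.1) * eY 0%N (t q.2)) +
  \sum_(q <- index_pairsY) 8 * (eY N (t q.1) * eX 0%N (t q.2)).

Lemma quant_kernel_cell2 N (t : 'I_6 -> T) :
  quant_kernel [ffun j => cell2 N (t j)] =
  f_kernel (quant sX N (piX (t 0))) (quant sX N (piX (t 1)))
    (quant sX N (piX (t 2))) (quant sX N (piX (t 3))) *
  f_kernel (quant sY N (piY (t 0))) (quant sY N (piY (t 1)))
    (quant sY N (piY (t 4))) (quant sY N (piY (t 5))).
Proof.
by rewrite /quant_kernel /four_point /quant_distX /quant_distY !ffunE /= !cellK.
Qed.

(** Distinct bounds on [q] are used against the two parts of the bound on [p]. *)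
Lemma ler_mul_split (p q e e' u v : R) : 0 <= e -> 0 <= e' -> 0 <= q ->
  p <= e + e' -> q <= u -> q <= v -> p * q <= e * u + e' * v.
Proof.
move=> e0 e'0 q0 pe qu qv; rewrite (le_trans (ler_wpM2r q0 pe))// mulrDl.
by rewrite lerD// ler_wpM2l.
Qed.

Lemma h_kernel_quant_dist N (t : 'I_6 -> T) :
  `|h_kernel (t : 'I_6 -> X * Y) - quant_kernel [ffun j => cell2 N (t j)]|
  <= quant_error N t.
Proof.
rewrite quant_kernel_cell2 /h_kernel (le_trans (dist_mul _ _ _ _))//.
rewrite /quant_error /index_pairsX /index_pairsY !big_cons !big_nil /=.
set x := fun i => (t i).1 : X; set y := fun i => (t i).2 : Y.
rewrite -/(x 0) -/(x 1) -/(x 2) -/(x 3) -/(y 0) -/(y 1) -/(y 4) -/(y 5).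
have fYu : `|f_kernel (y 0) (y 1) (y 4) (y 5)| <= 2 * (qerr sY 0 (y 1) + qerr sY 0 (y 4)).
  apply: le_trans (f_kernel_bound23 _ _ _ _) _.
  by rewrite ler_pM2l// mdist_base_le.
have fYv : `|f_kernel (y 0) (y 1) (y 4) (y 5)| <= 2 * (qerr sY 0 (y 0) + qerr sY 0 (y 5)).
  apply: le_trans (f_kernel_bound14 _ _ _ _) _.
  by rewrite ler_pM2l// mdist_base_le.
set fX' := f_kernel (quant sX N (x 0)) _ _ _.
have fXu : `|fX'| <= 4 * (qerr sX 0 (x 1) + qerr sX 0 (x 2)).
  apply: le_trans (f_kernel_bound23 _ _ _ _) _.
  have := quant_mdist_le sX N (x 1) (x 2); lra.
have fXv : `|fX'| <= 4 * (qerr sX 0 (x 0) + qerr sX 0 (x 3)).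
  apply: le_trans (f_kernel_bound14 _ _ _ _) _.
  have := quant_mdist_le sX N (x 0) (x 3); lra.
have dX4 : `|f_kernel (x 0) (x 1) (x 2) (x 3) - fX'| <= 2 * qerr sX N (x 0) +
    2 * (qerr sX N (x 1) + qerr sX N (x 2) + qerr sX N (x 3)).
  apply: le_trans (f_kernel_dist _ _ _ _ _ _ _ _) _; rewrite /qerr; lra.
set fY' := f_kernel (quant sY N (y 0)) _ _ _.
have dY4 : `|f_kernel (y 0) (y 1) (y 4) (y 5) - fY'| <= 2 * qerr sY N (y 0) +
    2 * (qerr sY N (y 1) + qerr sY N (y 4) + qerr sY N (y 5)).
  apply: le_trans (f_kernel_dist _ _ _ _ _ _ _ _) _; rewrite /qerr; lra.
rewrite [X in _ + X <= _]mulrC.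
have pX i : 0 <= qerr sX N (x i) by exact: qerr_ge0.
have pY i : 0 <= qerr sY N (y i) by exact: qerr_ge0.
apply: le_trans (lerD (ler_mul_split _ _ _ dX4 fYu fYv) (ler_mul_split _ _ _ dY4 fXu fXv)) _;
  rewrite ?normr_ge0 ?mulr_ge0 ?addr_ge0//.
rewrite le_eqVlt; apply/orP; left; apply/eqP; ring.
Qed.

Lemma V_quant_error (z : nat -> T) (N n : nat) : (0 < n)%N ->
  Vstat (quant_error N) (fun i : 'I_n => z i) =
  32 * (avg (eX N) z n * avg (eY 0%N) z n) + 64 * (avg (eY N) z n * avg (eX 0%N) z n).
Proof.
move=> n0.
have VD (F G : ('I_6 -> T) -> R) : Vstat (fun t => F t + G t) (fun i : 'I_n => z i) =
    Vstat F (fun i : 'I_n => z i) + Vstat G (fun i : 'I_n => z i).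
  by rewrite /Vstat big_split mulrDr.
rewrite VD (Vstat_sum z index_pairsX (fun q t => 4 * (eX N (t q.1) * eY 0%N (t q.2)))).
rewrite (Vstat_sum z index_pairsY (fun q t => 8 * (eY N (t q.1) * eX 0%N (t q.2)))).
rewrite /index_pairsX /index_pairsY !big_cons !big_nil.
do 8 (rewrite (VstatZ z 4 (fun t => eX N (t _) * eY 0%N (t _))) (Vstat_mul2 z (eX N) (eY 0%N))//).
do 8 (rewrite (VstatZ z 8 (fun t => eY N (t _) * eX 0%N (t _))) (Vstat_mul2 z (eY N) (eX 0%N))//).
ring.
Qed.

(** The sequence of observations is fixed here; its three properties assumed below
    hold almost surely by the laws of large numbers. *)
Section sample.
Variable z : nat -> T.
Hypothesis cell_frequency : forall N c,
  avg (fun x => (cell2 N x == c)%:R) z n @[n --> \oo] --> cell_mass theta (cell2 N) c.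
Hypothesis avg_eX : forall N c, 2 * \int[theta]_x eX N x < c ->
  \forall n \near \oo, avg (eX N) z n <= c.
Hypothesis avg_eY : forall N c, 2 * \int[theta]_x eY N x < c ->
  \forall n \near \oo, avg (eY N) z n <= c.

(** The factor [2] is that of [avg_limsup_le]; the terms [N.+1^-1] and [1] make the
    inequalities strict. *)
Definition error_bound (N : nat) : R :=
  32 * ((2 * \int[theta]_x eX N x + N.+1%:R^-1) * (2 * \int[theta]_x eY 0%N x + 1)) +
  64 * ((2 * \int[theta]_x eY N x + N.+1%:R^-1) * (2 * \int[theta]_x eX 0%N x + 1)).

Lemma error_bound_cvg0 : error_bound N @[N --> \oo] --> 0.
Proof.
pose cY := 2 * \int[theta]_x eY 0%N x + 1; pose cX := 2 * \int[theta]_x eX 0%N x + 1.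
rewrite -[X in _ --> X](_ : 32 * ((2 * 0 + 0) * cY) + 64 * ((2 * 0 + 0) * cX) = 0).
  have iX := Rintegral_qerr_cvg0 mX momentX dX.
  have iY := Rintegral_qerr_cvg0 mY momentY dY.
  have h := @cvg_harmonic R.
  apply: cvgD; apply: cvgMl_tmp; apply: cvgMr_tmp; apply: cvgD => //;
    exact: cvgMl_tmp.
by ring.
Qed.

Lemma V_quant_error_near N :
  \forall n \near \oo, Vstat (quant_error N) (fun i : 'I_n => z i) <= error_bound N.
Proof.
have N0 : 0 < N.+1%:R^-1 :> R by rewrite invr_gt0.
have lt_eps (a c : R) : 0 < c -> a < a + c by move=> c0; rewrite ltrDl.
have nX := avg_eX (lt_eps (2 * \int[theta]_x eX N x) _ N0).
have nY := avg_eY (lt_eps (2 * \int[theta]_x eY N x) _ N0).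
have nX0 := avg_eX (lt_eps (2 * \int[theta]_x eX 0%N x) 1 ltr01).
have nY0 := avg_eY (lt_eps (2 * \int[theta]_x eY 0%N x) 1 ltr01).
apply: filterS2 (filterI nX nY0) (filterI (filterI nY nX0) (nbhs_infty_gt 0)).
move=> n [uX vY] [[uY vX] n0]; rewrite V_quant_error// /error_bound.
have X0 M : 0 <= avg (eX M) z n by apply: avg_ge0 => x; exact: qerr_ge0.
have Y0 M : 0 <= avg (eY M) z n by apply: avg_ge0 => x; exact: qerr_ge0.
by rewrite lerD// ler_pM2l// ler_pM.
Qed.

Let kernel_bound N : R := \sum_c `|@quant_kernel N c|.

Lemma quant_kernel_bound N (t : 'I_6 -> T) :
  `|quant_kernel [ffun j => cell2 N (t j)]| <= kernel_bound N.
Proof.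
rewrite /kernel_bound (bigD1 [ffun j => cell2 N (t j)])//= lerDl.
by apply: sumr_ge0 => c _.
Qed.

Lemma V_quant_kernel_cvg N :
  Vstat (fun t => quant_kernel [ffun j => cell2 N (t j)]) (fun i : 'I_n => z i)
  @[n --> \oo] --> quant_dcov N.
Proof.
exact: (@Vstat_factor_cvg R T 6 z _ _ _ (@quant_kernel N) (@cell_frequency N)).
Qed.

Lemma sample_Vstat_cvg :
  Vstat (@h_kernel R X Y) (fun i : 'I_n => z i) @[n --> \oo] --> dcov theta.
Proof.
exact: (Vstat_cvg_approx h_kernel_quant_dist V_quant_kernel_cvg
  V_quant_error_near error_bound_cvg0 quant_dcov_cvg).
Qed.

Lemma sample_Ustat_cvg :
  Ustat (@h_kernel R X Y) (fun i : 'I_n => z i) @[n --> \oo] --> dcov theta.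
Proof.
exact: (Ustat_cvg_approx h_kernel_quant_dist quant_kernel_bound
  V_quant_kernel_cvg V_quant_error_near error_bound_cvg0 quant_dcov_cvg).
Qed.

End sample.

Section iid_sample.
Context dOmega (Omega : measurableType dOmega) (P : probability Omega R).
Variable Z : nat -> {RV P >-> T}.
Hypothesis iidZ : iid Z theta.

Lemma ae_cell_frequency : {ae P, forall w, forall N c,
  avg (fun x => (cell2 N x == c)%:R) (Z ^~ w) n @[n --> \oo] -->
  cell_mass theta (cell2 N) c}.
Proof.
apply: ae_foralln => N; apply: filter_forall => c.
apply: (bounded_strong_law iidZ) => [|x].
  by apply: measurable_cell; exact: measurable_cell2_preimage.
by rewrite ler0n lern1 leq_b1.
Qed.

Lemma ae_estimators_cvg : {ae P, forall w,
  Ustat (@h_kernel R X Y) (fun i : 'I_n => Z i w) @[n --> \oo] --> dcov theta /\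
  Vstat (@h_kernel R X Y) (fun i : 'I_n => Z i w) @[n --> \oo] --> dcov theta}.
Proof.
have aeX : {ae P, forall w, forall N c, 2 * \int[theta]_x eX N x < c ->
    \forall n \near \oo, avg (eX N) (Z ^~ w) n <= c}.
  apply: ae_foralln => N; apply: (avg_limsup_le iidZ) => [x|].
    exact: qerr_ge0.
  exact: integrable_qerr.
have aeY : {ae P, forall w, forall N c, 2 * \int[theta]_x eY N x < c ->
    \forall n \near \oo, avg (eY N) (Z ^~ w) n <= c}.
  apply: ae_foralln => N; apply: (avg_limsup_le iidZ) => [x|].
    exact: qerr_ge0.
  exact: integrable_qerr.
apply: filterS3 ae_cell_frequency aeX aeY => w wc wX wY.
by split; [exact: (sample_Ustat_cvg wc wX wY)|exact: (sample_Vstat_cvg wc wX wY)].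
Qed.

End iid_sample.

End distance_covariance_limit.

Lemma finite_first_moment_pushforward (R : realType) (X : pmetricType R) d
    (T : measurableType d) (theta : probability T R) (pi : {mfun T >-> borel X}) :
  finite_first_moment (distribution theta pi) ->
  exists o : X, (\int[theta]_z (mdist (pi z : X) o)%:E < +oo)%E.
Proof.
case=> o oy; exists o; apply: le_lt_trans oy.
rewrite ge0_integral_pushforward//.
  by apply/measurable_EFinP; exact: measurable_mdist.
by move=> x _; rewrite lee_fin mdist_ge0.
Qed.

Theorem theorem5p5 (R : realType) (X Y : pmetricType R)
    (sepX : separable X) (sepY : separable Y)
    (dOmega : measure_display) (Omega : measurableType dOmega)
    (P : probability Omega R)
    (theta : probability (borel X * borel Y)%type R)
    (Z : nat -> {RV P >-> (borel X * borel Y)%type})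
    (iidZ : iid Z theta) (theta11 : M11 theta) :
  {ae P, forall w,
    Ustat (@h_kernel R X Y) (fun i : 'I_n => Z i w) @[n --> \oo] --> dcov theta} /\
  ((forall (x : X) (y : Y),
     ('E_P[fun w => ((mdist ((Z 0%N w).1 : X) x * mdist ((Z 0%N w).2 : Y) y)
                      `^ (5 / 6))%R] < +oo)%E) ->
   {ae P, forall w,
     Vstat (@h_kernel R X Y) (fun i : 'I_n => Z i w) @[n --> \oo] --> dcov theta}).
Proof.
have [/finite_first_moment_pushforward[oX mX] /finite_first_moment_pushforward[oY mY]] := theta11.
have [sX sX0 dX] := separable_dense_sequence oX sepX.
have [sY sY0 dY] := separable_dense_sequence oY sepY.
rewrite -{}sX0 in mX; rewrite -{}sY0 in mY.
have UV := ae_estimators_cvg dX dY mX mY iidZ.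
by split=> [|_]; apply: filterS UV => w [].
Qed.
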